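(* Let $q,\rho_{12},\rho_{13},\rho_{23}\in(-1,1)$ and put $r=\rho_{12}\rho_{13}\rho_{23}$. Let $f_{3D}(x,y,z|\rho_{12},\rho_{13},\rho_{23},q)$ be the joint density on $S(q)^3$ of a random vector $(X,Y,Z)$ defined in the context, with normalizing constant $C_{3D}$. Then: i) $C_{3D}=1-r$. ii) Each two-dimensional marginal depends (apart from $q$) on two parameters only. The marginal $f_{YZ}$ depends only on $\rho_{23}$ and $\rho_{12}\rho_{13}$: $$f_{YZ}(y,z|\rho_{12},\rho_{13},\rho_{23},q)=\int_{S(q)}f_{3D}(x,y,z|\rho_{12},\rho_{13},\rho_{23},q)\,dx$$ $$=(1-r)f_N(y|q)f_N(z|q)\frac{(\rho_{23}^2)_\infty(\rho_{12}^2\rho_{13}^2)_\infty}{\prod_{i=0}^\infty \omega_q(y,z|\rho_{23}q^i)\,\omega_q(y,z|\rho_{12}\rho_{13}q^i)}=(1-r)f_{CN}(y|z,\rho_{23},q)f_{CN}(z|y,\rho_{12}\rho_{13},q),$$ and similarly for $f_{XZ}$ (with $\rho_{13}$ and $\rho_{12}\rho_{23}$ in the roles of $\rho_{23}$ and $\rho_{12}\rho_{13}$) and for $f_{XY}$ (with $\rho_{12}$ and $\rho_{13}\rho_{23}$). iii) The one-dimensional marginal densities, e.g. $f_Z(z|\rho_{12},\rho_{13},\rho_{23},q)=\int_{S(q)}\int_{S(q)}f_{3D}(x,y,z|\rho_{12},\rho_{13},\rho_{23},q)\,dx\,dy$, depend (apart from $q$) only on the product $r$. Moreover $f_Z(z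|\rho_{12},\rho_{13},\rho_{23},q)=f_R(z|r,q)$.
   Context: For $|q|<1$ let $S(q)=[-2/\sqrt{1-q},\,2/\sqrt{1-q}]$ and $(a)_\infty=\prod_{k=0}^\infty(1-aq^k)$ (with $q^0=1$). Define $$l_q(x|a)=(1+a)^2-(1-q)ax^2,$$ $$\omega_q(x,y|\rho)=(1-\rho^2)^2-(1-q)xy\rho(1+\rho^2)+(1-q)\rho^2(x^2+y^2),$$ $$f_N(x|q)=\frac{(q)_\infty\sqrt{1-q}\sqrt{4-(1-q)x^2}}{2\pi}\prod_{i=1}^\infty l_q(x|q^i),\quad x\in S(q),$$ $$f_{CN}(x|y,\rho,q)=f_N(x|q)\frac{(\rho^2)_\infty}{\prod_{i=0}^\infty\omega_q(x,y|\rho q^i)},\quad x,y\in S(q),\ |\rho|<1.$$ The three-dimensional density is, for $x,y,z\in S(q)$, $$f_{3D}(x,y,z|\rho_{12},\rho_{13},\rho_{23},q)=f_N(x|q)f_N(y|q)f_N(z|q)\frac{C_{3D}(\rho_{12}^2)_\infty(\rho_{13}^2)_\infty(\rho_{23}^2)_\infty}{\prod_{i=0}^\infty\left(\omega_q(x,y|\rho_{12}q^i)\,\omega_q(x,z|\rho_{13}q^i)\,\omega_q(y,z|\rho_{23}q^i)\right)},$$ where $C_{3D}$ is the constant making $f_{3D}$ integrate to $1$ over $S(q)^3$. $f_{YZ},f_{XZ},f_{XY}$ and $f_X,f_Y,f_Z$ denote its marginal densities. The Rogers density with parameter $|\beta|<1$ is $$f_R(x|\beta,q)=f_N(x|q)\frac{(\beta^2)_\infty}{(\beta)_\infty(\beta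 q)_\infty\prod_{i=0}^\infty l_q(x|\beta q^i)},\quad x\in S(q).$$ *)

(* Defs.v *)
From HB Require Import structures.
From mathcomp Require Export all_boot all_order all_algebra.
From mathcomp Require Export all_classical all_reals all_analysis.
Export Order.TTheory GRing.Theory Num.Theory.
Export numFieldNormedType.Exports.

#[export] Set Implicit Arguments.
#[export] Unset Strict Implicit.
#[export] Unset Printing Implicit Defensive.

Local Open Scope classical_set_scope.
Local Open Scope ring_scope.

Definition iprod {R : realType} (u : nat -> R) : R :=
  limn (fun n => \prod_(0 <= i < n) u i).

Definition qpoch {R : realType} (q a : R) : R :=
  iprod (fun k => 1 - a * q ^+ k).

Definition Sq {R : realType} (q : R) : set R :=
  `[- 2 / Num.sqrt (1 - q), 2 / Num.sqrt (1 - q)].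

Definition lq {R : realType} (q x a : R) : R :=
  (1 + a) ^+ 2 - (1 - q) * a * x ^+ 2.

Definition omegaq {R : realType} (q x y rho : R) : R :=
  (1 - rho ^+ 2) ^+ 2 - (1 - q) * x * y * rho * (1 + rho ^+ 2)
  + (1 - q) * rho ^+ 2 * (x ^+ 2 + y ^+ 2).

(* The product over i >= 1 is indexed from 0. *)
Definition fN {R : realType} (q x : R) : R :=
  qpoch q q * Num.sqrt (1 - q) * Num.sqrt (4 - (1 - q) * x ^+ 2) / (2 * pi)
  * iprod (fun i => lq q x (q ^+ i.+1)).

Definition fCN {R : realType} (q x y rho : R) : R :=
  fN q x * (qpoch q (rho ^+ 2) / iprod (fun i => omegaq q x y (rho * q ^+ i))).

Definition fR {R : realType} (q x beta : R) : R :=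
  fN q x * (qpoch q (beta ^+ 2)
            / (qpoch q beta * qpoch q (beta * q)
               * iprod (fun i => lq q x (beta * q ^+ i)))).

Definition f3D_const {R : realType} (C q rho12 rho13 rho23 x y z : R) : R :=
  fN q x * fN q y * fN q z *
  ((C * qpoch q (rho12 ^+ 2) * qpoch q (rho13 ^+ 2) * qpoch q (rho23 ^+ 2))
   / iprod (fun i => omegaq q x y (rho12 * q ^+ i)
                     * omegaq q x z (rho13 * q ^+ i)
                     * omegaq q y z (rho23 * q ^+ i))).

(* The integral is with respect to Lebesgue measure on (R * R) * R. By linearity
   at most one C normalizes; the default 0 is never a normalizing constant. *)
Definition C3D {R : realType} (q rho12 rho13 rho23 : R) : R :=
  xget 0 [set C : R |
    (\int[(lebesgue_measure \x lebesgue_measure) \x lebesgue_measure]_(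
        p in (Sq q `*` Sq q) `*` Sq q)
      (f3D_const C q rho12 rho13 rho23 p.1.1 p.1.2 p.2)%:E = 1)%E].

Definition f3D {R : realType} (q rho12 rho13 rho23 x y z : R) : R :=
  f3D_const (C3D q rho12 rho13 rho23) q rho12 rho13 rho23 x y z.

Definition fYZ {R : realType} (q rho12 rho13 rho23 y z : R) : R :=
  \int[lebesgue_measure]_(x in Sq q) f3D q rho12 rho13 rho23 x y z.

Definition fXZ {R : realType} (q rho12 rho13 rho23 x z : R) : R :=
  \int[lebesgue_measure]_(y in Sq q) f3D q rho12 rho13 rho23 x y z.

Definition fXY {R : realType} (q rho12 rho13 rho23 x y : R) : R :=
  \int[lebesgue_measure]_(z in Sq q) f3D q rho12 rho13 rho23 x y z.

Definition fX {R : realType} (q rho12 rho13 rho23 x : R) : R :=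
  \int[lebesgue_measure]_(z in Sq q) \int[lebesgue_measure]_(y in Sq q)
    f3D q rho12 rho13 rho23 x y z.

Definition fY {R : realType} (q rho12 rho13 rho23 y : R) : R :=
  \int[lebesgue_measure]_(z in Sq q) \int[lebesgue_measure]_(x in Sq q)
    f3D q rho12 rho13 rho23 x y z.

Definition fZ {R : realType} (q rho12 rho13 rho23 z : R) : R :=
  \int[lebesgue_measure]_(y in Sq q) \int[lebesgue_measure]_(x in Sq q)
    f3D q rho12 rho13 rho23 x y z.

(* Main.v *)
From HB Require Import structures.
Require Import Defs.
From mathcomp Require Import ring lra zify measurable_realfun.
Local Open Scope classical_set_scope.
Local Open Scope ring_scope.

(** With [t = sqrt (1 - q) * x], the density [fN] is the orthogonality weight of
    the continuous q-Hermite polynomials [H_n (t)], with [L (H_m H_n) = (q)_n] if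
    [m = n] and [0] otherwise ([fN_orthogonal]), and the kernel
    [(rho^2)_oo / prod_i omega (x, y | rho q^i)] is the Poisson-Mehler sum
    [M_rho (x, y) = sum_n rho^n H_n (x) H_n (y) / (q)_n] ([mehler_formula]).
    Hence the three-dimensional density is [C fN fN fN M M M], and term-by-term
    integration gives two identities that contain the whole theorem:

    - [mehler_convolution]: integrating [fN (x) M_rho (x, y) M_sigma (x, z)] in
      [x] gives [M_(rho sigma) (y, z)];
    - [mehler_trace]: integrating [fN (x) M_r (x, x)] gives
      [sum_n r^n = 1 / (1 - r)].

    Integrating out one variable merges the two kernels that contain it, which is
    the formula for the two-dimensional marginals; integrating out a second one
    leaves [fN (z) M_r (z, z)], which is [fR (z) / (1 - r)] because
    [omega (z, z | r) = (1 - r)^2 l (z | r)] ([fR_mehler]). The last variable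
    contributes the trace, so the total mass is [C / (1 - r)] and [C = 1 - r].

    The Poisson-Mehler formula holds because both sides satisfy
    [omega (rho) F (rho) = (1 - rho^2) (1 - q rho^2) F (q rho)] with [F (0) = 1]:
    for the infinite product this is clear, and for the series it is a five-term
    recurrence that follows from [H_(n+1) = t H_n - (1 - q^n) H_(n-1)].

    For the orthogonality, the infinite product in [fN] is truncated after [N]
    factors, leaving a polynomial times the semicircle law. Its Chebyshev moments
    are Gaussian binomials (a finite Jacobi triple product); as [N] grows they
    give [L (U_2k) = (-1)^k q^(k(k+1)/2)] and [L (U_(2k+1)) = 0]. The three-term
    recurrences of both families then determine all mixed moments [L (H_n U_k)],
    in particular [L (H_n) = 0] for [n > 0], and with these all [L (H_m H_n)].

    The exchanges of limit and integral are instances of bounded convergence on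
    the compact support: [|H_n| <= M (n + 1)] on [[-2, 2]] and [1 / (q)_n] is
    bounded, so every series involved is dominated by a geometric one. *)

(** * Geometrically dominated series and infinite products *)

Section GeometricDomination.
Context {R : realType}.
Implicit Types (u v : nat -> R) (K s : R).

Lemma geom_sum_le K s n : 0 <= K -> 0 <= s < 1 ->
  \sum_(0 <= i < n) K * s ^+ i <= K / (1 - s).
Proof.
move=> K0 /andP[s0 s1]; have s1' : 0 < 1 - s by lra.
rewrite -mulr_sumr ler_wpM2l// -[leRHS]mul1r ler_pdivlMr//.
rewrite (_ : _ * _ = 1 - s ^+ n); first by rewrite gerBl exprn_ge0.
elim: n => [|n IH]; first by rewrite big_nil mul0r expr0 subrr.
by rewrite big_nat_recr//= mulrDl IH exprS; ring.
Qed.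

Lemma geom_series_bound u K s n : 0 <= s < 1 ->
  (forall i, `|u i| <= K * s ^+ i) -> `|series u n| <= K / (1 - s).
Proof.
move=> hs hu; have K0 : 0 <= K.
  by have := hu 0%N; rewrite expr0 mulr1; exact: le_trans.
apply: le_trans (geom_sum_le n K0 hs); rewrite seriesEnat /=.
by apply: le_trans (ler_norm_sum _ _ _) _; exact: ler_sum.
Qed.

Lemma geom_series_cvg u K s : 0 <= s < 1 ->
  (forall i, `|u i| <= K * s ^+ i) -> cvgn (series u).
Proof.
move=> hs hu; apply: normed_cvg; apply: (@series_le_cvg _ _ (geometric K s)).
- by move=> n /=.
- by move=> n /=; exact: le_trans (hu n).
- exact: hu.
- by apply: is_cvg_geometric_series; case/andP: hs => s0 s1; rewrite ger0_norm.
Qed.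

Lemma geom_prod_bound u K s n : 0 <= K -> 0 <= s < 1 ->
  (forall i, `|u i - 1| <= K * s ^+ i) ->
  `|\prod_(0 <= i < n) u i| <= expR (K / (1 - s)).
Proof.
move=> K0 hs hu.
suff h : `|\prod_(0 <= i < n) u i| <= expR (\sum_(0 <= i < n) K * s ^+ i).
  by apply: le_trans h _; rewrite ler_expR geom_sum_le.
rewrite expR_sum normr_prod; apply: ler_prod => i _; rewrite normr_ge0 /=.
apply: le_trans (expR_ge1Dx _).
rewrite -[X in `|X|](subrK 1).
by apply: le_trans (ler_normD _ _) _; rewrite normr1 addrC lerD2l.
Qed.

(** The partial products are the partial sums of their increments
    [P_n * (u n - 1)], which are geometrically small because [P_n] is bounded. *)
Lemma iprod_cvg u K s : 0 <= K -> 0 <= s < 1 ->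
  (forall i, `|u i - 1| <= K * s ^+ i) ->
  \prod_(0 <= i < n) u i @[n --> \oo] --> iprod u.
Proof.
move=> K0 hs hu; set P := fun n => \prod_(0 <= i < n) u i.
suff : cvgn P by [].
have PE : P = (fun n => 1 + series (fun n => P n * (u n - 1)) n).
  apply/funext => n; rewrite seriesEnat /=; elim: n => [|n IH].
    by rewrite /P !big_nil addr0.
  rewrite big_nat_recr//= addrA -IH {1}/P big_nat_recr//= -/(P n); ring.
rewrite PE; apply: is_cvgD; first exact: is_cvg_cst.
apply: (@geom_series_cvg _ (expR (K / (1 - s)) * K) s) => // i.
by rewrite normrM -mulrA ler_pM// geom_prod_bound.
Qed.

Lemma iprodE u (a : R) :
  \prod_(0 <= i < n) u i @[n --> \oo] --> a -> iprod u = a.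
Proof. by move=> ua; apply/cvg_lim. Qed.

Lemma iprodM u v (a b : R) : \prod_(0 <= i < n) u i @[n --> \oo] --> a ->
  \prod_(0 <= i < n) v i @[n --> \oo] --> b ->
  \prod_(0 <= i < n) (u i * v i) @[n --> \oo] --> a * b.
Proof. by move=> ua vb; under eq_fun do rewrite big_split; exact: cvgM. Qed.

Lemma iprod_ge0 u K s : 0 <= K -> 0 <= s < 1 ->
  (forall i, `|u i - 1| <= K * s ^+ i) -> (forall i, 0 <= u i) -> 0 <= iprod u.
Proof.
move=> K0 hs hu u0; apply: limr_ge; first exact: (iprod_cvg K0 hs).
by near=> n; exact: prodr_ge0.
Unshelve. all: by end_near. Qed.

Lemma iprodS u K s : 0 <= K -> 0 <= s < 1 ->
  (forall i, `|u i - 1| <= K * s ^+ i) ->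
  iprod u = u 0%N * iprod (fun i => u i.+1).
Proof.
move=> K0 hs hu; apply/cvg_lim => //; rewrite -cvg_shiftS /=.
rewrite (_ : (fun n => _) = (fun n => u 0%N * \prod_(0 <= i < n) u i.+1)); last first.
  by apply/funext => n; rewrite big_nat_recl.
apply: cvgMr; apply: (@iprod_cvg _ K s) => // i; apply: le_trans (hu _) _.
have /andP[s0 /ltW s1] := hs.
by rewrite ler_wpM2l// exprS ler_piMl// exprn_ge0.
Qed.

(** The reciprocals of the factors satisfy the same kind of bound, so their
    product converges too, to an inverse of the original product. *)
Lemma iprod_neq0 u K s d : 0 <= K -> 0 <= s < 1 -> 0 < d ->
  (forall i, `|u i - 1| <= K * s ^+ i) -> (forall i, d <= u i) -> iprod u != 0.
Proof.
move=> K0 hs d0 hu ud; have u0 i : 0 < u i by exact: lt_le_trans (ud i).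
have hv i : `|(u i)^-1 - 1| <= (K / d) * s ^+ i.
  rewrite (_ : _ - 1 = (1 - u i) / u i); last by rewrite mulrBl divff ?gt_eqF// mul1r.
  rewrite normrM distrC normfV (gtr0_norm (u0 i)) mulrAC.
  by apply: ler_pM; rewrite ?invr_ge0 ?(ltW (u0 i))// lef_pV2 ?posrE.
have Kd0 : 0 <= K / d by rewrite divr_ge0// ltW.
apply/eqP => iu0.
have := iprodE (iprodM (iprod_cvg K0 hs hu) (iprod_cvg Kd0 hs hv)).
rewrite iu0 mul0r /iprod (_ : (fun n => _) = fun=> 1); last first.
  by apply/funext => n; rewrite big1// => i _; rewrite divff// gt_eqF.
by rewrite lim_cst// => /eqP; rewrite oner_eq0.
Qed.

End GeometricDomination.

(** * Continuous q-Hermite polynomials *)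

Section QPochhammer.
Context {R : realType}.
Variable q : R.
Hypothesis hq : -1 < q < 1.

Let q1 : `|q| < 1. Proof. by rewrite ltr_norml. Qed.
Let q01 : 0 <= `|q| < 1. Proof. by rewrite normr_ge0. Qed.

Lemma qexp_le1 n : `|q ^+ n| <= 1.
Proof. by rewrite normrX exprn_ile1// ltW. Qed.

Lemma qpoch_factor a i : `|1 - a * q ^+ i - 1| <= `|a| * `|q| ^+ i.
Proof. by rewrite addrAC subrr add0r normrN normrM normrX. Qed.

Lemma qpoch_cvg a :
  \prod_(0 <= i < n) (1 - a * q ^+ i) @[n --> \oo] --> qpoch q a.
Proof. by apply: iprod_cvg q01 (qpoch_factor a). Qed.

Lemma qpochS a : qpoch q a = (1 - a) * qpoch q (a * q).
Proof.
rewrite /qpoch (iprodS _ q01 (qpoch_factor a))// expr0 mulr1; congr (_ * iprod _).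
by apply/funext => i; rewrite exprS mulrA.
Qed.

Lemma qpoch_ge0 a : `|a| < 1 -> 0 <= qpoch q a.
Proof.
move=> a1; apply: (iprod_ge0 _ q01 (qpoch_factor a)) => // i.
rewrite subr_ge0; apply: le_trans (ler_norm _) _.
by rewrite normrM -[leRHS]mulr1 ler_pM// ?qexp_le1// ltW.
Qed.

Lemma qpoch_neq0 a : `|a| < 1 -> qpoch q a != 0.
Proof.
move=> a1; have d0 : 0 < 1 - `|a| by rewrite subr_gt0.
apply: (iprod_neq0 _ q01 d0 (qpoch_factor a)) => // i.
rewrite lerD2l lerN2; apply: le_trans (ler_norm _) _.
by rewrite normrM -[leRHS]mulr1 ler_pM// qexp_le1.
Qed.

Definition qfact n : R := \prod_(0 <= i < n) (1 - q * q ^+ i).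

Lemma qfact0 : qfact 0 = 1. Proof. by rewrite /qfact big_nil. Qed.

Lemma qfactS n : qfact n.+1 = qfact n * (1 - q ^+ n.+1).
Proof. by rewrite /qfact big_nat_recr//= -exprS. Qed.

Lemma one_sub_qexp_neq0 n : 1 - q ^+ n.+1 != 0.
Proof.
rewrite subr_eq0 eq_sym lt_eqF//; apply: le_lt_trans (ler_norm _) _.
by rewrite normrX exprn_ilt1.
Qed.

Lemma qfact_neq0 n : qfact n != 0.
Proof.
elim: n => [|n IH]; first by rewrite qfact0 oner_neq0.
by rewrite qfactS mulf_neq0// one_sub_qexp_neq0.
Qed.

Lemma qfact_bounded :
  exists2 M, 0 <= M & forall n, `|qfact n| <= M /\ `|(qfact n)^-1| <= M.
Proof.
have c1 := @qpoch_cvg q.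
have c2 := cvgV (qpoch_neq0 q1) c1.
have /cvg_seq_bounded/pinfty_ex_gt0[M1 M1p h1] : cvgn qfact by apply/cvg_ex; eexists; exact: c1.
have /cvg_seq_bounded/pinfty_ex_gt0[M2 M2p h2] : cvgn (fun n => (qfact n)^-1)
  by apply/cvg_ex; eexists; exact: c2.
exists (M1 + M2) => [|n]; first by rewrite addr_ge0// ltW.
split; [have := h1 n I|have := h2 n I] => /= h; apply: le_trans h _.
  by rewrite lerDl ltW.
by rewrite lerDr ltW.
Qed.

(** The normalisation is that of the polynomials orthogonal on [[-2, 2]], with
    [hermite n (2 cos t)] being the classical [H_n (cos t | q)]. *)
Fixpoint hermite n : {poly R} :=
  match n with
  | 0 => 1
  | n1.+1 => match n1 with
             | 0 => 'X
             | n2.+1 => 'X * hermite n1 - (1 - q ^+ n1) *: hermite n2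
             end
  end.

Lemma hermiteSS n :
  hermite n.+2 = 'X * hermite n.+1 - (1 - q ^+ n.+1) *: hermite n.
Proof. by []. Qed.

Lemma hermiteSE n t : (hermite n.+2).[t] =
  t * (hermite n.+1).[t] - (1 - q ^+ n.+1) * (hermite n).[t].
Proof. by rewrite hermiteSS hornerD hornerN hornerZ hornerM hornerX. Qed.

Let b n := (qfact n)^-1.

Let bE n : b n = (1 - q ^+ n.+1) * b n.+1.
Proof.
by rewrite /b qfactS invfM mulrCA mulfV ?mulr1// one_sub_qexp_neq0.
Qed.

(** The coefficients of the generating function
    [1 / ((z e^(it))_oo (z e^(-it))_oo)], a Cauchy product of two copies of
    Euler's series [sum_n z^n / (q)_n]. *)
Let S t n := \sum_(0 <= j < n.+1) b j * b (n - j) * cos ((n%:R - 2 * j%:R) * t).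

Let cosD1 (m t : R) : 2 * cos t * cos (m * t) = cos ((m + 1) * t) + cos ((m - 1) * t).
Proof. by rewrite (mulrDl m 1) (mulrBl t m 1) mul1r (cosD (m * t) t) (cosB (m * t) t); ring. Qed.

Let S_rec t n : (1 - q ^+ n.+2) * S t n.+2 = 2 * cos t * S t n.+1 - S t n.
Proof.
have -> : 2 * cos t * S t n.+1 =
   \sum_(0 <= j < n.+2) b j * b (n.+1 - j) * cos ((n.+2%:R - 2 * j%:R) * t)
 + \sum_(0 <= j < n.+2) b j * b (n.+1 - j) * cos ((n%:R - 2 * j%:R) * t).
  rewrite mulr_sumr -big_split/=; apply: eq_bigr => j _.
  rewrite mulrCA cosD1 mulrDr; congr (_ * cos (_ * _) + _ * cos (_ * _)).
    by rewrite -[n.+2%:R]natr1; ring.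
  by rewrite -[n.+1%:R]natr1; ring.
rewrite {1}/S big_nat_recr//= big_nat_recl//= subn0 subnn.
rewrite [X in _ = X + _ - _]big_nat_recl//= [X in _ = _ + X - _]big_nat_recr//= subn0 subnn.
have -> : S t n = \sum_(0 <= j < n.+1) b j * b (n - j) *
    cos ((n.+2%:R - 2 * j.+1%:R) * t).
  apply: eq_bigr => j _; congr (_ * cos (_ * _)).
  by rewrite -[n.+2%:R]natr1 -[n.+1%:R]natr1 -[j.+1%:R]natr1; ring.
have -> : \sum_(0 <= j < n.+1) b j * b (n.+1 - j) * cos ((n%:R - 2 * j%:R) * t)
   = \sum_(0 <= j < n.+1) b j * b (n.+1 - j) * cos ((n.+2%:R - 2 * j.+1%:R) * t).
  apply: eq_bigr => j _; congr (_ * cos (_ * _)).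
  by rewrite -[n.+2%:R]natr1 -[n.+1%:R]natr1 -[j.+1%:R]natr1; ring.
have -> : (n%:R - 2 * n.+1%:R) * t = - ((n.+2%:R - 2 * 0) * t).
  by rewrite -[n.+2%:R]natr1 -[n.+1%:R]natr1; ring.
have -> : (n.+2%:R - 2 * n.+2%:R) * t = - ((n.+2%:R - 2 * 0) * t) by ring.
rewrite !cosN (bE n.+1); set c := cos _.
rewrite !mulrDr mulr_sumr.
have -> : \sum_(0 <= i < n.+1) (1 - q ^+ n.+2) *
   (b i.+1 * b (n.+2 - i.+1) * cos ((n.+2%:R - 2 * i.+1%:R) * t)) =
   \sum_(0 <= j < n.+1) b j.+1 * b (n.+1 - j.+1) * cos ((n.+2%:R - 2 * j.+1%:R) * t) +
   \sum_(0 <= j < n.+1) b j * b (n.+1 - j) * cos ((n.+2%:R - 2 * j.+1%:R) * t) -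
   \sum_(0 <= j < n.+1) b j * b (n - j) * cos ((n.+2%:R - 2 * j.+1%:R) * t).
  rewrite -sumrN -!big_split/=; apply: eq_big_nat => j /andP[_ jn].
  rewrite !subSS -mulrDl -mulrBl subSn// (bE (n - j)) (bE j).
  rewrite mulrA; congr (_ * _).
  rewrite (_ : n.+2 = (j.+1 + (n - j).+1)%N); last by lia.
  by rewrite exprD; ring.
ring.
Qed.

(** The three-term recurrence of the Cauchy product comes down to
    [1 - a b = (1 - a) + (1 - b) - (1 - a) (1 - b)] with [a = q^j] and
    [b = q^(n - j)]. This closed form is what makes [hermite_bound] immediate. *)
Lemma hermite_cos n t : (hermite n).[2 * cos t] = qfact n * S t n.
Proof.
have b0 : b 0 = 1 by rewrite /b qfact0 invr1.
have h0 : (hermite 0).[2 * cos t] = qfact 0 * S t 0.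
  by rewrite /S big_nat1 subnn b0 qfact0 !mulr0 subrr mul0r cos0 hornerC !mulr1.
suff [] : (hermite n).[2 * cos t] = qfact n * S t n /\
  (hermite n.+1).[2 * cos t] = qfact n.+1 * S t n.+1 by [].
elim: n => [|n [IH1 IH2]].
  split=> //; rewrite /S big_nat_recr//= big_nat1 /= b0 hornerX qfactS qfact0.
  have := bE 0; rewrite b0 => /esym b1.
  rewrite mulr0 subr0 (_ : 1%:R - 2 * 1%:R = -1); last by ring.
  rewrite !mulN1r mul1r cosN mul1r mulr1 mul1r -mulrDr mulrA b1; ring.
split=> //; rewrite hermiteSE IH1 IH2 (qfactS n.+1) -mulrA S_rec mulrBr; congr (_ - _).
  by ring.
by rewrite qfactS; ring.
Qed.

Lemma hermite_bound : exists2 M, 0 <= M &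
  forall n t, `|t| <= 2 -> `|(hermite n).[t]| <= M * n.+1%:R.
Proof.
have [M M0 hM] := qfact_bounded.
exists (M * (M * M)) => [|n t]; first by rewrite !mulr_ge0.
move=> t2; have ht : -1 <= t / 2 <= 1 by move: t2; rewrite ler_norml; lra.
have -> : t = 2 * cos (acos (t / 2)).
  by rewrite acosK ?in_itv//= mulrCA divff ?mulr1.
rewrite hermite_cos normrM -mulrA; apply: ler_pM => //; first exact: (hM n).1.
rewrite -[n.+1%:R]/(n.+1 - 0)%:R -[n.+1 in leRHS]subn0 mulr_natr -sumr_const_nat.
apply: le_trans (ler_norm_sum _ _ _) _; apply: ler_sum => j _.
rewrite !normrM -[leRHS]mulr1; apply: ler_pM; rewrite ?mulr_ge0//.
  by apply: ler_pM => //; exact: (hM _).2.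
by rewrite ler_norml cos_geN1 cos_le1.
Qed.

End QPochhammer.

(** Splitting [rho ^+ n] into four equal powers leaves room to absorb two linear
    factors. *)
Lemma quad_geom_le {R : realType} (rho : R) : `|rho| < 1 ->
  exists K s, [/\ 0 <= K, 0 <= s < 1 &
    forall n, n.+1%:R ^+ 2 * `|rho| ^+ n <= K * s ^+ n].
Proof.
move=> r1; set a := Num.sqrt (Num.sqrt `|rho|).
have a0 : 0 <= a by exact: sqrtr_ge0.
have aE : `|rho| = a ^+ 2 ^+ 2 by rewrite !sqr_sqrtr ?sqrtr_ge0.
have a1 : a < 1.
  rewrite ltNge; apply/negP => a1; move: r1; rewrite aE ltNge => /negP; apply.
  by rewrite !exprn_ege1.
have lin n : n.+1%:R * a ^+ n <= (1 - a)^-1.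
  rewrite -[leRHS]div1r; apply: le_trans (@geom_sum_le _ 1 a n.+1 _ _) => //.
    rewrite mulr_natl -[n.+1 in leLHS]subn0 -sumr_const_nat ler_sum_nat// => i.
    by move=> /andP[_ im]; rewrite mul1r ler_wiXn2l// ltW.
  by rewrite a0.
exists ((1 - a)^-1 ^+ 2), (a ^+ 2); split => [||n].
- by rewrite sqr_ge0.
- by rewrite exprn_ge0//= exprn_ilt1.
- rewrite aE (_ : _ * _ = (n.+1%:R * a ^+ n) ^+ 2 * a ^+ 2 ^+ n); last first.
    by rewrite [in RHS]exprMn -[RHS]mulrA -!exprM -[X in _ = _ * X]exprD; congr (_ * a ^+ _); lia.
  rewrite ler_wpM2r ?exprn_ge0//; rewrite !expr2; apply: ler_pM => //.
    by rewrite mulr_ge0// exprn_ge0.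
  by rewrite mulr_ge0// exprn_ge0.
Qed.

(** * The Poisson-Mehler kernel *)

Section Sums.
Context {R : realType}.
Implicit Types (u v : nat -> R) (l m : R).

(** Multiplication of a generating function by its variable. *)
Definition delay u n : R := if n is m.+1 then u m else 0.

Lemma sums_delay u l : series u @ \oo --> l -> series (delay u) @ \oo --> l.
Proof.
move=> ul; rewrite -cvg_shiftS /= (_ : (fun n => _) = series u)//.
by apply/funext => n; rewrite !seriesEnat /= big_nat_recl//= add0r.
Qed.

Lemma sumsD u v l m : series u @ \oo --> l -> series v @ \oo --> m ->
  series (fun n => u n + v n) @ \oo --> l + m.
Proof.
move=> ul vm; rewrite (_ : series _ = series u \+ series v); first exact: cvgD.
by apply/funext => n; rewrite /= !seriesEnat /= big_split.
Qed.

Lemma sumsZ a u l : series u @ \oo --> l -> series (fun n => a * u n) @ \oo --> a * l.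
Proof.
move=> ul; rewrite (_ : series _ = (fun n => a * series u n)); first exact: cvgMr.
by apply/funext => n; rewrite /= !seriesEnat /= mulr_sumr.
Qed.

Lemma geom_squeeze u l C s : 0 <= s < 1 ->
  (forall n, `|u n - l| <= C * s ^+ n) -> u @ \oo --> l.
Proof.
move=> /andP[s0 s1] h.
have g0 : geometric C s @ \oo --> 0 by apply: cvg_geometric; rewrite ger0_norm.
apply/subr_cvg0.
apply: (@squeeze_cvgr _ _ _ _ (fun n => - geometric C s n) (geometric C s)) => //.
  by near=> n; rewrite -ler_norml h.
by rewrite -oppr0; exact: cvgN.
Unshelve. all: by end_near. Qed.

End Sums.
Arguments sumsZ {R} a {u l} _.

Section Mehler.
Context {R : realType}.
Variable q : R.
Hypothesis hq : -1 < q < 1.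

Let q01 : 0 <= `|q| < 1. Proof. by rewrite normr_ge0 ltr_norml. Qed.

(** [omegaq] in the rescaled variables [t = sqrt (1 - q) * x]. *)
Definition omega_scaled (t s rho : R) :=
  (1 - rho ^+ 2) ^+ 2 - t * s * rho * (1 + rho ^+ 2) + rho ^+ 2 * (t ^+ 2 + s ^+ 2).

(** A square plus a nonnegative multiple of [4 - s ^+ 2]. *)
Lemma omega_scaled_ge0 t s rho : `|s| <= 2 -> 0 <= omega_scaled t s rho.
Proof.
move=> hs.
have -> : omega_scaled t s rho = (rho * t - (1 + rho ^+ 2) * s / 2) ^+ 2
                        + (1 - rho ^+ 2) ^+ 2 * (1 - (s / 2) ^+ 2).
  by rewrite /omega_scaled; field.
rewrite addr_ge0 ?sqr_ge0// mulr_ge0 ?sqr_ge0// subr_ge0 -real_normK ?num_real//.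
by rewrite exprn_ile1// normrM [`|2^-1|]ger0_norm; lra.
Qed.

Lemma omega_scaled_factor t s rho i : `|t| <= 2 -> `|s| <= 2 -> `|rho| < 1 ->
  `|omega_scaled t s (rho * q ^+ i) - 1| <= 19 * `|q| ^+ i.
Proof.
move=> ht hs hr; set z := rho * q ^+ i.
have hz : `|z| <= `|q| ^+ i.
  by rewrite normrM normrX ler_piMl ?exprn_ge0// ltW.
have hz1 : `|z| <= 1 by apply: le_trans hz _; rewrite -normrX qexp_le1.
have -> : omega_scaled t s z - 1 =
    z * ((- 2 * z + z ^+ 3) + (z * t ^+ 2 + z * s ^+ 2 - t * s * (1 + z ^+ 2))).
  by rewrite /omega_scaled; ring.
rewrite normrM mulrC; apply: ler_pM => //.
have t2 : `|t ^+ 2| <= 4 by rewrite normrX (_ : 4 = 2 ^+ 2) ?lerXn2r ?nnegrE//; ring.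
have s2 : `|s ^+ 2| <= 4 by rewrite normrX (_ : 4 = 2 ^+ 2) ?lerXn2r ?nnegrE//; ring.
have b1 : `|z ^+ 3| <= 1 by rewrite normrX exprn_ile1.
have b2 : `|z * t ^+ 2| <= 1 * 4 by rewrite normrM ler_pM.
have b3 : `|z * s ^+ 2| <= 1 * 4 by rewrite normrM ler_pM.
have z2 : `|1 + z ^+ 2| <= 2.
  apply: le_trans (ler_normD _ _) _; rewrite normr1 (_ : 2 = 1 + 1) ?lerD2l; last by ring.
  by rewrite normrX exprn_ile1.
have b4 : `|t * s * (1 + z ^+ 2)| <= 2 * 2 * 2 by rewrite !normrM !ler_pM ?mulr_ge0.
move: hz1 b1 b2 b3 b4; rewrite !ler_norml; lra.
Qed.

Lemma omega_scaled_cvg t s rho : `|t| <= 2 -> `|s| <= 2 -> `|rho| < 1 ->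
  \prod_(0 <= i < n) omega_scaled t s (rho * q ^+ i) @[n --> \oo]
  --> iprod (fun i => omega_scaled t s (rho * q ^+ i)).
Proof.
by move=> ht hs hr; apply: (iprod_cvg _ q01 (fun i => omega_scaled_factor i ht hs hr)).
Qed.

Definition mehler_coef t s n : R :=
  (hermite q n).[t] * (hermite q n).[s] / qfact q n.

Lemma mehler_coef_bound : exists2 M, 0 <= M & forall n t s, `|t| <= 2 -> `|s| <= 2 ->
  `|mehler_coef t s n| <= M * n.+1%:R ^+ 2.
Proof.
have [M M0 hM] := hermite_bound hq; have [M' M0' hM'] := qfact_bounded hq.
exists (M * M * M') => [|n t s ht hs]; first by rewrite !mulr_ge0.
have -> : M * M * M' * n.+1%:R ^+ 2 = M * n.+1%:R * (M * n.+1%:R) * M' by ring.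
rewrite !normrM; apply: ler_pM; rewrite ?mulr_ge0//; last exact: (hM' n).2.
by apply: ler_pM => //; exact: hM.
Qed.

Lemma mehler_term_bound rho : `|rho| < 1 -> exists K a, [/\ 0 <= K, 0 <= a < 1 &
  forall n t s, `|t| <= 2 -> `|s| <= 2 -> `|mehler_coef t s n * rho ^+ n| <= K * a ^+ n].
Proof.
move=> hr; have [M M0 hM] := mehler_coef_bound; have [K [a [K0 ha hK]]] := quad_geom_le hr.
exists (M * K), a; split => [||n t s ht hs]; rewrite ?mulr_ge0//.
rewrite normrM normrX -mulrA; apply: le_trans (_ : M * n.+1%:R ^+ 2 * `|rho| ^+ n <= _).
  by rewrite ler_wpM2r ?exprn_ge0 ?hM.
by rewrite -mulrA ler_wpM2l.
Qed.

Definition mehler_sum rho t s n := series (fun i => mehler_coef t s i * rho ^+ i) n.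
Definition mehler rho t s := limn (mehler_sum rho t s).

Lemma mehler_sum_cvg rho t s : `|rho| < 1 -> `|t| <= 2 -> `|s| <= 2 ->
  mehler_sum rho t s @ \oo --> mehler rho t s.
Proof.
move=> hr ht hs; have [K [a [K0 ha hK]]] := mehler_term_bound hr.
exact: (geom_series_cvg ha (fun i => hK i t s ht hs)).
Qed.

(** A five-term recurrence for the products of Hermite polynomials; it only
    expresses the two three-term recurrences. Multiplied by [rho ^+ n] and
    summed, it is the functional equation [mehler_qshift]. *)
Lemma mehler_coef_rec rho t s n (c := fun n => mehler_coef t s n * rho ^+ n)
    (d := fun n => q ^+ n * c n) :
  c n + - (t * s * rho) * delay c n
  + (rho ^+ 2 * (t ^+ 2 + s ^+ 2 - 2)) * delay (delay c) n
  + - (t * s * rho ^+ 3) * delay (delay (delay c)) n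
  + rho ^+ 4 * delay (delay (delay (delay c))) n
  = d n + - ((1 + q) * rho ^+ 2) * delay (delay d) n
    + (q * rho ^+ 4) * delay (delay (delay (delay d))) n.
Proof.
have e m := one_sub_qexp_neq0 hq m.
have h0 z : (hermite q 0).[z] = 1 by rewrite hornerC.
have h1 z : (hermite q 1).[z] = z by rewrite hornerX.
rewrite /d /c /mehler_coef /delay.
case: n => [|[|[|[|n]]]]; rewrite ?(hermiteSE, h0, h1) ?qfactS ?qfact0 ?exprS ?expr0 ?mulr1.
- by ring.
- by field; have := e 0; rewrite expr1.
- by field; have := e 0; have := e 1; rewrite !exprS expr0 !mulr1 => -> ->.
- field; have := e 0; have := e 1; have := e 2.
  by rewrite !exprS expr0 !mulr1 => -> -> ->.
have := e n; have := e n.+1; have := e n.+2; have := e n.+3; rewrite !exprS.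
have := qfact_neq0 hq n.
set Q := q ^+ n; set P := rho ^+ n; set F := qfact q n.
set A := (hermite q n).[t]; set B := (hermite q n.+1).[t].
set A' := (hermite q n).[s]; set B' := (hermite q n.+1).[s].
by move=> f0 e4 e3 e2 e1; field; rewrite f0 e1 e2 e3 e4.
Qed.

Lemma qscale_lt1 rho N : `|rho| < 1 -> `|rho * q ^+ N| < 1.
Proof.
move=> hr; rewrite normrM; apply: le_lt_trans hr.
by rewrite ler_piMr// qexp_le1.
Qed.

Lemma mehler_qshift rho t s : `|rho| < 1 -> `|t| <= 2 -> `|s| <= 2 ->
  omega_scaled t s rho * mehler rho t s =
  (1 - rho ^+ 2) * (1 - rho ^+ 2 * q) * mehler (rho * q) t s.
Proof.
move=> hr ht hs; set c := fun n => mehler_coef t s n * rho ^+ n.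
set d := fun n => q ^+ n * c n.
have cl : series c @ \oo --> mehler rho t s by exact: mehler_sum_cvg.
have dl : series d @ \oo --> mehler (rho * q) t s.
  rewrite (_ : d = (fun i => mehler_coef t s i * (rho * q) ^+ i)).
    by apply: mehler_sum_cvg => //; have := qscale_lt1 1 hr; rewrite expr1.
  by apply/funext => i; rewrite /d /c exprMn; ring.
have cl1 := sums_delay cl; have cl2 := sums_delay cl1.
have cl3 := sums_delay cl2; have cl4 := sums_delay cl3.
have dl2 := sums_delay (sums_delay dl); have dl4 := sums_delay (sums_delay dl2).
have L := sumsD (sumsD (sumsD (sumsD cl (sumsZ (- (t * s * rho)) cl1))
  (sumsZ (rho ^+ 2 * (t ^+ 2 + s ^+ 2 - 2)) cl2)) (sumsZ (- (t * s * rho ^+ 3)) cl3))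
  (sumsZ (rho ^+ 4) cl4).
have D := sumsD (sumsD dl (sumsZ (- ((1 + q) * rho ^+ 2)) dl2))
  (sumsZ (q * rho ^+ 4) dl4).
have E := cvg_lim (@norm_hausdorff _ _) L.
rewrite (funext (mehler_coef_rec rho t s)) in E.
rewrite (cvg_lim (@norm_hausdorff _ _) D) in E.
rewrite (_ : omega_scaled t s rho * _ = mehler rho t s + - (t * s * rho) * mehler rho t s +
    rho ^+ 2 * (t ^+ 2 + s ^+ 2 - 2) * mehler rho t s +
    - (t * s * rho ^+ 3) * mehler rho t s + rho ^+ 4 * mehler rho t s).
  by rewrite -E; ring.
by rewrite /omega_scaled; ring.
Qed.

Lemma mehler_iter rho t s N : `|rho| < 1 -> `|t| <= 2 -> `|s| <= 2 ->
  \prod_(0 <= i < N) omega_scaled t s (rho * q ^+ i) * mehler rho t s =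
  \prod_(0 <= i < (N * 2)%N) (1 - rho ^+ 2 * q ^+ i) * mehler (rho * q ^+ N) t s.
Proof.
move=> hr ht hs; elim: N => [|N IH]; first by rewrite !big_nil expr0 mulr1.
rewrite big_nat_recr//= mulrAC IH -mulrA [_ * omega_scaled _ _ _]mulrC.
rewrite mehler_qshift ?qscale_lt1// mulSn add2n big_nat_recr//= big_nat_recr//=.
rewrite (_ : rho * q ^+ N.+1 = rho * q ^+ N * q); last by rewrite exprSr mulrA.
rewrite (exprS q (N * 2)) (_ : q ^+ (N * 2) = q ^+ N * q ^+ N); last by rewrite muln2 -addnn exprD.
ring.
Qed.

(** Every term but the first carries a factor [q ^+ N]. *)
Lemma mehler_qexp_cvg1 rho t s : `|rho| < 1 -> `|t| <= 2 -> `|s| <= 2 ->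
  mehler (rho * q ^+ N) t s @[N --> \oo] --> (1 : R).
Proof.
move=> hr ht hs; have [K [a [K0 ha hK]]] := mehler_term_bound hr.
apply: (@geom_squeeze _ _ _ (K / (1 - a)) `|q|) => // N.
have hc := mehler_sum_cvg (qscale_lt1 N hr) ht hs.
have {}hc : `|mehler_sum (rho * q ^+ N) t s n.+1 - 1| @[n --> \oo]
    --> `|mehler (rho * q ^+ N) t s - 1|.
  by apply: cvg_norm; apply: cvgB (cvg_cst _); rewrite cvg_shiftS.
rewrite -(cvg_lim _ hc)//; apply: limr_le; first by apply/cvg_ex; eexists; exact: hc.
near=> n; rewrite /mehler_sum seriesEnat /= big_nat_recl//= /mehler_coef !hornerC qfact0.
rewrite divr1 expr0 !mulr1 addrAC subrr add0r -[leRHS]mulrAC.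
apply: (@geom_series_bound _ (fun i => mehler_coef t s i.+1 * (rho * q ^+ N) ^+ i.+1)
   (K * `|q| ^+ N)) => // i.
rewrite exprMn mulrA normrM (_ : q ^+ N ^+ _ = q ^+ N * q ^+ (N * i)); last first.
  by rewrite -exprM mulnS exprD.
apply: le_trans (_ : K * a ^+ i.+1 * `|q| ^+ N <= _).
  apply: ler_pM => //; rewrite ?hK// normrM normrX ler_piMr ?exprn_ge0//.
  exact: qexp_le1.
rewrite mulrAC ler_wpM2l ?mulr_ge0 ?exprn_ge0//; case/andP: ha => a0 a1.
by rewrite exprS ler_piMl ?exprn_ge0// ltW.
Unshelve. all: by end_near. Qed.

(** Iterating [mehler_qshift] pushes [rho] to [0], where the series is [1]. *)
Theorem mehler_formula rho t s : `|rho| < 1 -> `|t| <= 2 -> `|s| <= 2 ->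
  iprod (fun i => omega_scaled t s (rho * q ^+ i)) * mehler rho t s = qpoch q (rho ^+ 2).
Proof.
move=> hr ht hs.
have L : \prod_(0 <= i < N) omega_scaled t s (rho * q ^+ i) * mehler rho t s @[N --> \oo]
    --> iprod (fun i => omega_scaled t s (rho * q ^+ i)) * mehler rho t s.
  by apply: cvgMl; exact: omega_scaled_cvg.
rewrite -(cvg_lim _ L)//; apply/cvg_lim => //.
under eq_fun do rewrite mehler_iter//.
have A := cvg_comp (fun N => N * 2)%N _ (@cvg_mulnr 2 isT) (@qpoch_cvg _ _ hq (rho ^+ 2)).
by have := cvgM A (mehler_qexp_cvg1 hr ht hs); rewrite mulr1; exact.
Qed.

Lemma mehlerE rho t s : `|rho| < 1 -> `|t| <= 2 -> `|s| <= 2 ->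
  mehler rho t s = qpoch q (rho ^+ 2) / iprod (fun i => omega_scaled t s (rho * q ^+ i)).
Proof.
move=> hr ht hs; have E := mehler_formula hr ht hs.
have r2 : `|rho ^+ 2| < 1 by rewrite normrX exprn_ilt1.
have /negP := qpoch_neq0 hq r2; rewrite -E mulf_eq0 => /negP.
by rewrite negb_or => /andP[p0 _]; rewrite mulrC mulKf.
Qed.

Lemma mehler_ge0 rho t s : `|rho| < 1 -> `|t| <= 2 -> `|s| <= 2 -> 0 <= mehler rho t s.
Proof.
move=> hr ht hs; rewrite mehlerE// divr_ge0//.
  by apply: (qpoch_ge0 hq); rewrite normrX exprn_ilt1.
apply: (iprod_ge0 _ q01 (fun i => omega_scaled_factor i ht hs hr)) => // i.
exact: omega_scaled_ge0.
Qed.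

End Mehler.

(** * From Chebyshev moments to orthogonality *)

(** For [q = 0] the Hermite recurrence is that of the Chebyshev polynomials of
    the second kind, [cheb n] being [U_n (t / 2)]. *)
Definition cheb {R : realType} (n : nat) : {poly R} := hermite 0 n.

Lemma chebSS {R : realType} n : cheb n.+2 = 'X * cheb n.+1 - cheb n :> {poly R}.
Proof. by rewrite /cheb hermiteSS expr0n /= subr0 scale1r. Qed.

Lemma mulX_cheb {R : realType} n : 'X * cheb n.+1 = cheb n.+2 + cheb n :> {poly R}.
Proof. by rewrite chebSS subrK. Qed.

Section Orthogonality.
Context {R : realType}.
Variable q : R.
Hypothesis hq : -1 < q < 1.
Variable L : {poly R} -> R.
Hypothesis LD : forall p r, L (p + r) = L p + L r.
Hypothesis LZ : forall a p, L (a *: p) = a * L p.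
Hypothesis L_even : forall k, L (cheb k.*2) = (-1) ^+ k * q ^+ 'C(k.+1, 2).
Hypothesis L_odd : forall k, L (cheb k.*2.+1) = 0.

Let LB p r : L (p - r) = L p - L r.
Proof. by rewrite LD -scaleN1r LZ mulN1r. Qed.

Let H := hermite q.

Let m n j := (-1) ^+ j * q ^+ 'C(j.+1, 2) * qfact q (n + j) / qfact q j.

Let mE n j : m n.+1 j.+1 + m n.+1 j - (1 - q ^+ n.+1) * m n j.+1 = m n.+2 j.
Proof.
have e := one_sub_qexp_neq0 hq j; have f := qfact_neq0 hq j.
have C2 : q ^+ 'C(j.+2, 2) = q ^+ 'C(j.+1, 2) * (q * q ^+ j).
  by rewrite binS bin1 exprD exprS.
rewrite /m C2 [(-1) ^+ j.+1]exprS !addSn !addnS !qfactS.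
move: e; rewrite !exprS exprD => e.
by set P := q ^+ 'C(_, _); field; rewrite e f.
Qed.

Let m1E j : m 0 j.+1 + m 0 j = m 1 j.
Proof.
have f := qfact_neq0 hq j; have f' := qfact_neq0 hq j.+1.
rewrite /m !add0n add1n !mulfK// qfactS binS bin1 exprD [(-1) ^+ j.+1]exprS !exprS.
by set P := q ^+ 'C(_, _); field.
Qed.

Let HSV n k : L (H n.+2 * cheb k.+1) =
  L (H n.+1 * cheb k.+2) + L (H n.+1 * cheb k) - (1 - q ^+ n.+1) * L (H n * cheb k.+1).
Proof.
rewrite /H hermiteSS mulrBl -scalerAl LB LZ -LD -mulrDr -mulX_cheb.
by rewrite mulrCA mulrA.
Qed.

(** The three-term recurrences of the two families determine the mixed moments
    [L (H_n U_k)] from those with [n = 0]; [mE] is what they become for the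
    closed form [m]. *)
Let mixed n :
  [/\ forall j, L (H n * cheb (n + j.*2)) = m n j,
      forall j, L (H n * cheb (n + j.*2).+1) = 0 &
      forall k, (k < n)%N -> L (H n * cheb k) = 0].
Proof.
suff [] : [/\ forall j, L (H n * cheb (n + j.*2)) = m n j,
      forall j, L (H n * cheb (n + j.*2).+1) = 0 &
      forall k, (k < n)%N -> L (H n * cheb k) = 0] /\
  [/\ forall j, L (H n.+1 * cheb (n.+1 + j.*2)) = m n.+1 j,
      forall j, L (H n.+1 * cheb (n.+1 + j.*2).+1) = 0 &
      forall k, (k < n.+1)%N -> L (H n.+1 * cheb k) = 0] by [].
elim: n => [|n [[a b c] [a' b' c']]].
  have H0 k : H 0 * cheb k = cheb k by rewrite mul1r.
  have m0 j : L (cheb j.*2) = m 0 j by rewrite L_even /m add0n mulfK// qfact_neq0.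
  split; split=> [j|j|k] //; rewrite ?H0 ?add0n ?L_odd//.
  - by rewrite /H mulX_cheb LD -doubleS !m0 m1E.
  - by rewrite /H mulX_cheb LD add1n -doubleS !L_odd addr0.
  - by case: k => // _; rewrite /H mulr1; have := L_odd 0.
split=> //; split=> [j|j|k].
- rewrite addSn HSV -mE; congr (_ + _ - _ * _).
  + by rewrite -a' doubleS !addnS.
  + by rewrite -a'.
  + by rewrite -a doubleS !addnS.
- rewrite addSn HSV b' (_ : (n.+1 + j.*2).+3 = (n.+1 + j.+1.*2).+1) ?b'; last by lia.
  rewrite (_ : (n.+1 + j.*2).+2 = (n + j.+1.*2).+1) ?b; last by lia.
  by ring.
- case: k => [_|k].
    rewrite /H hermiteSS mulr1 LB LZ.
    have -> : 'X * hermite q n.+1 = H n.+1 * cheb 1 by rewrite mulrC.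
    have -> : hermite q n = H n * cheb 0 by rewrite mulr1.
    case: n => [|n] in a b c a' b' c' *.
      have := a' 0; have := a 0; rewrite double0 !addn0 => -> ->.
      rewrite /m !addn0 qfactS qfact0 bin_small// !expr0; ring.
    by rewrite c' // c // mulr0 subr0.
  rewrite !ltnS leq_eqVlt => /orP[/eqP->|].
    rewrite HSV (c' n)//; have := b 0; have := b' 0; rewrite double0 !addn0 => -> ->.
    by rewrite mulr0 subr0 addr0.
  case: n => // n in a b c a' b' c' *.
  rewrite ltnS leq_eqVlt => /orP[/eqP->|kn].
    rewrite HSV (c' n)//; have := a 0; have := a' 0; rewrite double0 !addn0 => -> ->.
    rewrite /m !addn0 [qfact q n.+2]qfactS; ring.
  by rewrite HSV !c' ?c//; first ring; lia.
Qed.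

Lemma L_hermite n : L (H n) = (n == 0%N)%:R.
Proof.
have HE : H n = H n * cheb 0 by rewrite mulr1.
have [a _ c] := mixed n; rewrite HE; case: n => [|n] in a c HE *; last by rewrite c.
have := a 0; rewrite double0 addn0 => ->.
by rewrite /m addn0 qfact0 bin_small// !expr0 divr1 !mulr1.
Qed.

Let mulXH k : 'X * H k.+1 = H k.+2 + (1 - q ^+ k.+1) *: H k.
Proof. by rewrite /H hermiteSS subrK. Qed.

(** Moving one factor [t] from one polynomial to the other reduces [L (H_k H_n)]
    to [L (H_j)]. *)
Lemma hermite_orthogonal k n : L (H k * H n) = (k == n)%:R * qfact q n.
Proof.
suff [] : (forall k, L (H k * H n) = (k == n)%:R * qfact q n) /\
          (forall k, L (H k * H n.+1) = (k == n.+1)%:R * qfact q n.+1) by [].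
elim: n {k} => [|n [IH1 IH2]].
  split=> k; first by rewrite mulr1 L_hermite qfact0 mulr1.
  rewrite mulrC /H; case: k => [|k]; first by rewrite mulr1 mul0r; exact: (L_hermite 1).
  rewrite mulXH LD LZ !L_hermite add0r eqSS qfactS qfact0 mul1r mulrC.
  by case: k => [|k] //; rewrite ?mul0r.
split=> // k; rewrite {2}/H hermiteSS mulrBr LB -scalerAr LZ IH1 mulrCA mulrA.
case: k => [|k].
  rewrite (_ : 'X * H 0 = H 1); last by rewrite /H mulr1.
  rewrite -/(H n.+1) IH2; case: n {IH1 IH2} => [|n]; last by rewrite /=; ring.
  by rewrite qfactS qfact0 /=; ring.
rewrite mulXH mulrDl LD -scalerAl LZ -/(H n.+1) !IH2 !eqSS [qfact q n.+2]qfactS.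
case: (k =P n.+1) => [->|_].
  by rewrite (_ : (n.+2 == n) = false) /=; [ring|lia].
case: (k.+1 =P n) => [->|_]; rewrite ?qfactS /=; ring.
Qed.

End Orthogonality.

(** * Integration over the support *)

Section FTC.
Context {R : realType}.
Local Notation mu := lebesgue_measure.

Lemma is_derive_continuous (F f : R -> R) :
  (forall x : R, is_derive x 1 F (f x)) -> continuous F.
Proof.
by move=> dF x; apply/differentiable_continuous/derivable1_diffP; have [] := dF x.
Qed.

Lemma is_derive_LRcontinuous (F f : R -> R) a b :
  (forall x : R, is_derive x 1 F (f x)) -> derivable_oo_LRcontinuous F a b.
Proof.
move=> dF; have cF := is_derive_continuous dF.
split=> [x _||]; first by have [] := dF x.
  by apply: cvg_at_right_filter; exact: cF.
by apply: cvg_at_left_filter; exact: cF.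
Qed.

Lemma is_derive_derive1 (F f : R -> R) :
  (forall x : R, is_derive x 1 F (f x)) -> F^`()%classic = f.
Proof. by move=> dF; apply/funext => x; rewrite derive1E; have [] := dF x. Qed.

Lemma is_derive_integral (F f : R -> R) a b : a < b ->
  (forall x : R, is_derive x 1 F (f x)) -> continuous f ->
  (\int[mu]_(x in `[a, b]) (f x)%:E = (F b - F a)%:E)%E.
Proof.
move=> ab dF cf; rewrite EFinB; apply: continuous_FTC2 => //.
- exact: continuous_subspaceT.
- exact: is_derive_LRcontinuous dF.
- by move=> x _; rewrite (is_derive_derive1 dF).
Qed.

Lemma is_derive_scale (f : R -> R) (c x d : R) :
  is_derive x 1 f d -> is_derive x 1 (fun y => c * f y) (c * d).
Proof. by move=> df; apply: (@is_deriveZ _ _ _ f c x 1 d). Qed.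

Lemma is_derive_sin_lin (c x : R) : c != 0 ->
  is_derive x 1 (fun y => sin (c * y) / c) (cos (c * x)).
Proof.
move=> c0.
have h1 : is_derive x 1 (fun y => c * y) (c * 1).
  by exact: (is_derive_scale c (is_derive_id x (1 : R))).
have h2 := is_derive1_comp (is_derive_sin (c * x)) h1.
rewrite (_ : (fun y => _) = (fun y => c^-1 * (sin \o (fun y => c * y)) y)).
  by apply: is_derive_eq; rewrite -[_ *: _]/(c^-1 * _) mulr1 mulrCA mulVf ?mulr1.
by apply/funext => y /=; rewrite mulrC.
Qed.

Lemma continuous_cos_lin (c : R) : continuous (fun y => cos (c * y)).
Proof.
move=> x; apply: continuous_comp; last exact: continuous_cos.
by apply: cvgMr; exact: cvg_id.
Qed.

Lemma sin_npi n : sin (n%:R * pi) = 0 :> R.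
Proof.
elim: n => [|n IH]; first by rewrite mul0r sin0.
by rewrite -natr1 mulrDl mul1r sinDpi IH oppr0.
Qed.

Lemma integral_cos n :
  (\int[mu]_(x in `[0%R : R, pi]) (cos (n%:R * x))%:E = ((n == 0%N)%:R * pi)%:E)%E.
Proof.
case: n => [|n].
  have d0 (x : R) : is_derive x 1 id (cos (0%:R * x)).
    by rewrite mul0r cos0; exact: is_derive_id.
  rewrite (is_derive_integral (pi_gt0 R) d0); first by rewrite subr0 mul1r.
  exact: continuous_cos_lin.
have n0 : n.+1%:R != 0 :> R by rewrite pnatr_eq0.
rewrite (is_derive_integral (pi_gt0 R) (fun x => is_derive_sin_lin x n0)).
  by rewrite sin_npi mulr0 sin0 !mul0r subr0.
exact: continuous_cos_lin.
Qed.

End FTC.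

(** The classical [U_n (cos t) sin t = sin ((n + 1) t)]. *)
Lemma cheb_sin {R : realType} n (t : R) : (cheb n).[2 * cos t] * sin t = sin (n.+1%:R * t).
Proof.
suff [] : (cheb n).[2 * cos t] * sin t = sin (n.+1%:R * t) /\
  (cheb n.+1).[2 * cos t] * sin t = sin (n.+2%:R * t) by [].
elim: n => [|n [IH1 IH2]].
  rewrite /cheb /= hornerC hornerX !mul1r; split=> //.
  by rewrite (_ : 2%:R * t = t + t) ?sinD; ring.
split=> //; rewrite chebSS hornerD hornerN hornerM hornerX mulrBl IH1 -mulrA IH2.
rewrite (_ : n.+3%:R * t = n.+2%:R * t + t); last by rewrite -[n.+3%:R]natr1; ring.
rewrite (_ : n.+1%:R * t = n.+2%:R * t - t); last by rewrite -[n.+2%:R]natr1; ring.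
by rewrite (sinD _ t) (sinB _ t); ring.
Qed.

Section Semicircle.
Context {R : realType}.
Variable q : R.
Hypothesis hq : -1 < q < 1.
Local Notation mu := lebesgue_measure.

Local Notation k := (Num.sqrt (1 - q)).
Let k0 : 0 < k. Proof. by rewrite sqrtr_gt0 subr_gt0; case/andP: hq. Qed.
Let k2 : k ^+ 2 = 1 - q. Proof. by rewrite sqr_sqrtr// subr_ge0 ltW//; case/andP: hq. Qed.

Definition rescale (x : R) := Num.sqrt (1 - q) * x.

Lemma rescale_le2 x : Sq q x -> `|rescale x| <= 2.
Proof.
rewrite /Sq /= in_itv/= mulNr -ler_norml => h.
by rewrite normrM (gtr0_norm k0) mulrC -ler_pdivlMr.
Qed.

Lemma rescale_sqr x : rescale x ^+ 2 = (1 - q) * x ^+ 2.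
Proof. by rewrite exprMn k2. Qed.

Lemma continuous_poly_rescale (p : {poly R}) : continuous (fun x => p.[rescale x]).
Proof.
move=> x; apply: continuous_comp; last exact: continuous_horner.
by apply: cvgMr; exact: cvg_id.
Qed.

Definition semicircle (x : R) : R := k * Num.sqrt (4 - (1 - q) * x ^+ 2) / (2 * pi).

Lemma continuous_semicircle : continuous semicircle.
Proof.
move=> x; apply: cvgMl; apply: cvgMr.
apply: continuous_comp; last exact: sqrt_continuous.
by apply: cvgB; [exact: cvg_cst|apply: cvgMr; exact: exprn_continuous].
Qed.

Lemma semicircle_ge0 x : 0 <= semicircle x.
Proof. by rewrite divr_ge0 ?mulr_ge0 ?sqrtr_ge0 ?pi_ge0. Qed.

Lemma semicircle_bound x : `|semicircle x| <= k * 2 / (2 * pi).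
Proof.
rewrite ger0_norm ?semicircle_ge0// ler_wpM2r ?invr_ge0 ?mulr_ge0 ?pi_ge0//.
rewrite ler_wpM2l ?sqrtr_ge0// -[leRHS]ger0_norm// -sqrtr_sqr ler_wsqrtr//.
have : 0 <= (1 - q) * x ^+ 2 by rewrite -rescale_sqr sqr_ge0.
by rewrite (_ : 2 ^+ 2 = 4) ?lerBlDr ?lerDl//; ring.
Qed.

(** The substitution [x = 2 cos t / sqrt (1 - q)] turns the Chebyshev moments of
    the semicircle law into integrals of [sin t * sin ((n + 1) t)]. *)
Lemma semicircle_cheb n :
  (\int[mu]_(x in Sq q) (semicircle x * (cheb n).[rescale x])%:E = (n == 0%N)%:R%:E)%E.
Proof.
set F := fun t : R => (2 / k) * cos t.
have dF (t : R) : is_derive t 1 F ((2 / k) * - sin t) by exact: is_derive_scale.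
have F'E := is_derive_derive1 dF.
have cF' : continuous F^`()%classic.
  by rewrite F'E => x; apply: cvgMr; apply: cvgN; exact: continuous_sin.
have -> : Sq q = `[F pi, F 0]%classic.
  by rewrite /Sq /F cospi cos0 mulrN1 mulr1 mulNr.
rewrite integration_by_substitution_decreasing ?pi_ge0//; first last.
- apply: continuous_subspaceT => x; apply: cvgM; first exact: continuous_semicircle.
  exact: continuous_poly_rescale.
- exact: is_derive_LRcontinuous dF.
- by apply/cvg_ex; eexists; apply: cvg_at_left_filter; exact: cF'.
- by apply/cvg_ex; eexists; apply: cvg_at_right_filter; exact: cF'.
- by move=> x y hx hy xy; rewrite ltr_pM2l ?divr_gt0// ltr_cos.
transitivity (\int[mu]_(x in `[0%R : R, pi])
   (pi^-1 * (cos (n%:R * x) - cos (n.+2%:R * x)))%:E)%E.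
  apply: eq_integral => t; rewrite inE/= in_itv/= => ht; congr EFin.
  rewrite -[LHS]/(semicircle (F t) * (cheb n).[rescale (F t)] * - F^`()%classic t) F'E.
  have -> : rescale (F t) = 2 * cos t.
    by rewrite /rescale /F mulrA mulrCA divff ?mulr1// gt_eqF.
  have -> : semicircle (F t) = k / pi * sin t.
    rewrite /semicircle -rescale_sqr.
    have -> : rescale (F t) = 2 * cos t.
      by rewrite /rescale /F mulrA mulrCA divff ?mulr1// gt_eqF.
    have -> : 4 - (2 * cos t) ^+ 2 = (2 * sin t) ^+ 2.
      by rewrite !exprMn sin2cos2; ring.
    rewrite sqrtr_sqr ger0_norm ?mulr_ge0 ?sin_ge0_pi//.
    by move: (gt_eqF (pi_gt0 R)); move: (@pi R) => p p0; field; rewrite p0.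
  rewrite (mulrN (2 / k)) opprK.
  transitivity (2 / pi * (sin t * ((cheb n).[2 * cos t] * sin t))).
    move: (gt_eqF (pi_gt0 R)) (gt_eqF k0); move: (@pi R) => p p0 k0'.
    by field; rewrite p0 k0'.
  rewrite cheb_sin (_ : n%:R * t = n.+1%:R * t - t); last by rewrite -[n.+1%:R]natr1; ring.
  rewrite (_ : n.+2%:R * t = n.+1%:R * t + t); last by rewrite -[n.+2%:R]natr1; ring.
  by rewrite (cosD _ t) (cosB _ t); ring.
have ic m : mu.-integrable `[0, pi] (EFin \o (fun t : R => cos (m%:R * t))).
  apply: continuous_compact_integrable; first exact: segment_compact.
  by apply: continuous_subspaceT; exact: continuous_cos_lin.
under eq_integral do rewrite EFinM EFinB.
rewrite integralZl//; last first.
  by have := integrableB _ (ic n) (ic n.+2); exact.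
rewrite integralB//.
transitivity (((pi : R)^-1)%:E * (((n == 0%N)%:R * pi)%:E - (0 * pi : R)%:E))%E.
  by rewrite -integral_cos (_ : 0 = (n.+2 == 0%N)%:R :> R)// -integral_cos.
rewrite mul0r sube0 -EFinM; congr EFin.
by case: (n == _); rewrite ?mul0r ?mulr0// mul1r mulVf// gt_eqF ?pi_gt0.
- exact: ic.
- exact: ic.
Qed.

End Semicircle.

Section BoundedIntegrals.
Context {R : realType}.
Variable q : R.
Hypothesis hq : -1 < q < 1.
Local Notation mu := lebesgue_measure.

Lemma measurable_Sq : measurable (Sq q).
Proof. exact: measurable_itv. Qed.

Lemma Sq_bounded_integrable (f : R -> R) M : measurable_fun (Sq q) f ->
  (forall x, Sq q x -> `|f x| <= M) -> mu.-integrable (Sq q) (EFin \o f).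
Proof.
move=> mf fM; apply: measurable_bounded_integrable => //; first exact: measurable_Sq.
  by apply: compact_finite_measure; exact: segment_compact.
exists M; split; first exact: num_real.
by move=> y My x Sx /=; apply: le_trans (fM x Sx) _; exact: ltW.
Qed.

Lemma Sq_bounded_cvg (f_ : nat -> R -> R) (f : R -> R) M :
  (forall n, measurable_fun (Sq q) (f_ n)) ->
  (forall n x, Sq q x -> `|f_ n x| <= M) ->
  (forall x, Sq q x -> f_ n x @[n --> \oo] --> f x) ->
  (\int[mu]_(x in Sq q) (f_ n x)%:E)%E @[n --> \oo]
  --> (\int[mu]_(x in Sq q) (f x)%:E)%E.
Proof.
move=> mf fM cf.
apply: (@dominated_cvg _ _ _ mu (Sq q) measurable_Sq (fun n x => (f_ n x)%:E)
  (fun x => (f x)%:E) (fun=> M%:E)) => //.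
- by move=> n; apply/measurable_EFinP; exact: mf.
- by move=> x Sx; apply: cvg_EFin; [exact: nearW|exact: cf].
- apply: (@Sq_bounded_integrable (fun=> M) `|M|) => // x _.
Qed.

Lemma cvg_le_norm (u : nat -> R) (l M : R) : u @ \oo --> l ->
  (forall n, `|u n| <= M) -> `|l| <= M.
Proof.
move=> ul uM; have h : `|u n| @[n --> \oo] --> `|l| by exact: cvg_norm.
rewrite -(cvg_lim _ h)//; apply: limr_le; first by apply/cvg_ex; eexists; exact: h.
by apply: nearW => n; exact: uM.
Qed.

Lemma measurable_poly_rescale (p : {poly R}) :
  measurable_fun (Sq q) (fun x => p.[rescale q x]).
Proof.
apply: measurable_funTS; apply: continuous_measurable_fun.
exact: continuous_poly_rescale.
Qed.

Lemma poly_rescale_bound (p : {poly R}) :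
  exists2 M, 0 <= M & forall x, Sq q x -> `|p.[rescale q x]| <= M.
Proof.
have [M hM] := poly_disk_bound p 2; exists `|M| => // x Sx.
by apply: le_trans (ler_norm _); apply: hM; exact: rescale_le2.
Qed.

(** The linear functional on polynomials attached to a weight on the support;
    polynomials are read in the rescaled variable. *)
Definition wint (w : R -> R) (p : {poly R}) :=
  \int[mu]_(x in Sq q) (w x * p.[rescale q x]).

Section Wint.
Variables (w : R -> R) (B : R).
Hypothesis mw : measurable_fun (Sq q) w.
Hypothesis wB : forall x, Sq q x -> `|w x| <= B.

Lemma wint_integrable p :
  mu.-integrable (Sq q) (EFin \o (fun x => w x * p.[rescale q x])).
Proof.
have [M M0 hM] := poly_rescale_bound p.
apply: (@Sq_bounded_integrable _ (B * M)) => [|x Sx].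
  by apply: measurable_funM => //; exact: measurable_poly_rescale.
by rewrite normrM ler_pM// ?wB ?hM.
Qed.

Lemma wintE p : (\int[mu]_(x in Sq q) (w x * p.[rescale q x])%:E = (wint w p)%:E)%E.
Proof.
rewrite /wint /Rintegral fineK//.
by apply: integrable_fin_num; [exact: measurable_Sq|exact: wint_integrable].
Qed.

Lemma wintD p r : wint w (p + r) = wint w p + wint w r.
Proof.
rewrite /wint -RintegralD//; [|exact: measurable_Sq|exact: wint_integrable..].
by apply: eq_Rintegral => x _; rewrite hornerD mulrDr.
Qed.

Lemma wintZ a p : wint w (a *: p) = a * wint w p.
Proof.
rewrite /wint -RintegralZl//; [|exact: measurable_Sq|exact: wint_integrable].
by apply: eq_Rintegral => x _; rewrite hornerZ mulrCA.
Qed.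

End Wint.
End BoundedIntegrals.

(** * Moments of the q-Hermite weight *)

Section Weight.
Context {R : realType}.
Variable q : R.
Hypothesis hq : -1 < q < 1.
Local Notation mu := lebesgue_measure.

Let q01 : 0 <= `|q| < 1. Proof. by rewrite normr_ge0 ltr_norml. Qed.

Lemma lq_factor b x i : `|b| <= 1 -> Sq q x ->
  `|lq q x (b * q ^+ i) - 1| <= 7 * `|q| ^+ i.
Proof.
move=> hb Sx; set a := b * q ^+ i.
have ha : `|a| <= `|q| ^+ i by rewrite normrM normrX ler_piMl ?exprn_ge0.
have ha1 : `|a| <= 1 by apply: le_trans ha _; rewrite -normrX qexp_le1.
have -> : lq q x a - 1 = (2 + a - rescale q x ^+ 2) * a.
  by rewrite /lq rescale_sqr//; ring.
have t2 : `|rescale q x ^+ 2| <= 4.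
  by rewrite normrX (_ : 4 = 2 ^+ 2) ?lerXn2r ?nnegrE ?rescale_le2//; ring.
rewrite normrM; apply: ler_pM => //.
move: t2 ha1; rewrite !ler_norml; lra.
Qed.

(** With [s = t / 2] in [[-1, 1]] the value is
    [(1 + a)^2 (1 - s^2) + (1 - a)^2 s^2]. *)
Lemma lq_ge0 x a : Sq q x -> 0 <= lq q x a.
Proof.
move=> Sx; have := rescale_le2 hq Sx.
have -> : lq q x a = (1 + a) ^+ 2 - a * rescale q x ^+ 2.
  by rewrite /lq rescale_sqr//; ring.
move: (rescale q x) => t ht.
have -> : (1 + a) ^+ 2 - a * t ^+ 2
    = (1 + a) ^+ 2 * (1 - (t / 2) ^+ 2) + (1 - a) ^+ 2 * (t / 2) ^+ 2 by field.
rewrite addr_ge0// mulr_ge0 ?sqr_ge0// subr_ge0 -real_normK ?num_real//.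
by rewrite exprn_ile1// normrM [`|2^-1|]ger0_norm; lra.
Qed.

Definition lq_poly (a : R) : {poly R} := ((1 + a) ^+ 2)%:P - a *: ('X * 'X).

Lemma lq_polyE x a : (lq_poly a).[rescale q x] = lq q x a.
Proof.
rewrite /lq_poly hornerD hornerN hornerZ hornerM hornerX hornerC -expr2 rescale_sqr//.
by rewrite /lq; ring.
Qed.

Definition weight_poly N := \prod_(0 <= i < N) lq_poly (q ^+ i.+1).

Lemma weight_polyE N x : (weight_poly N).[rescale q x] = \prod_(0 <= i < N) lq q x (q ^+ i.+1).
Proof. by rewrite horner_prod; apply: eq_bigr => i _; exact: lq_polyE. Qed.

Let lfac x i : Sq q x -> `|lq q x (q ^+ i.+1) - 1| <= 7 * `|q| ^+ i.
Proof. by move=> Sx; rewrite exprS lq_factor//; case/andP: q01 => _ /ltW. Qed.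

Lemma fNE x : fN q x =
  qpoch q q * semicircle q x * iprod (fun i => lq q x (q ^+ i.+1)).
Proof. by rewrite /fN /semicircle !mulrA. Qed.

Definition weightN N x := qpoch q q * semicircle q x * (weight_poly N).[rescale q x].

Lemma weightN_cvg x : Sq q x -> weightN N x @[N --> \oo] --> fN q x.
Proof.
move=> Sx; rewrite fNE /weightN; apply: cvgMr.
rewrite (_ : (fun n => _) = (fun N => \prod_(0 <= i < N) lq q x (q ^+ i.+1))).
  by apply: (iprod_cvg _ q01 (fun i => lfac i Sx)).
by apply/funext => N; rewrite weight_polyE.
Qed.

Lemma weightN_bound : exists2 B, 0 <= B & forall N x, Sq q x -> `|weightN N x| <= B.
Proof.
exists (`|qpoch q q| * (Num.sqrt (1 - q) * 2 / (2 * pi)) * expR (7 / (1 - `|q|))).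
  by rewrite mulr_ge0 ?expR_ge0// mulr_ge0// divr_ge0 ?mulr_ge0 ?sqrtr_ge0 ?pi_ge0.
move=> N x Sx; rewrite normrM [`|_ * semicircle _ _|]normrM; apply: ler_pM; rewrite ?mulr_ge0//.
  by rewrite ler_wpM2l// semicircle_bound.
by rewrite weight_polyE; apply: (geom_prod_bound _ _ q01 (fun i => lfac i Sx)).
Qed.

Lemma measurable_weightN N : measurable_fun (Sq q) (weightN N).
Proof.
apply: measurable_funM; last exact: measurable_poly_rescale.
apply: measurable_funM => //; apply: measurable_funTS.
by apply: continuous_measurable_fun; exact: continuous_semicircle.
Qed.

Lemma measurable_fN : measurable_fun (Sq q) (fN q).
Proof. by apply: (measurable_fun_cvg measurable_weightN) => x; exact: weightN_cvg. Qed.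

Lemma fN_bound : exists2 B, 0 <= B & forall x, Sq q x -> `|fN q x| <= B.
Proof.
have [B B0 hB] := weightN_bound; exists B => // x Sx.
by apply: cvg_le_norm (weightN_cvg Sx) _ => N; exact: hB.
Qed.

Lemma fN_ge0 x : Sq q x -> 0 <= fN q x.
Proof.
move=> Sx; rewrite fNE mulr_ge0//.
  by rewrite mulr_ge0 ?semicircle_ge0// (qpoch_ge0 hq)//; case/andP: q01.
by apply: (iprod_ge0 _ q01 (fun i => lfac i Sx)) => // i; exact: lq_ge0.
Qed.

(** Reduces the moments of [fN] to those of polynomials against the semicircle
    law. *)
Lemma wint_fN_cvg p :
  qpoch q q * wint q (semicircle q) (weight_poly N * p) @[N --> \oo] --> wint q (fN q) p.
Proof.
have [B B0 hB] := weightN_bound; have [M M0 hM] := poly_rescale_bound hq p.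
have h : (\int[mu]_(x in Sq q) (weightN N x * p.[rescale q x])%:E)%E @[N --> \oo]
    --> (\int[mu]_(x in Sq q) (fN q x * p.[rescale q x])%:E)%E.
  apply: (@Sq_bounded_cvg _ q _ _ (B * M)) => [N|N x Sx|x Sx].
  - by apply: measurable_funM; [exact: measurable_weightN|exact: measurable_poly_rescale].
  - by rewrite normrM ler_pM// ?hB ?hM.
  - by apply: cvgMl; exact: weightN_cvg.
have [B' B0' hB'] := fN_bound.
rewrite (wintE hq measurable_fN hB') in h.
apply: cvg_trans (fine_cvg h); rewrite (_ : (fun N => _) = (fun N =>
   fine (\int[mu]_(x in Sq q) (weightN N x * p.[rescale q x])%:E)%E))//.
apply/funext => N.
have ms : measurable_fun (Sq q) (semicircle q).
  by apply: measurable_funTS; apply: continuous_measurable_fun; exact: continuous_semicircle.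
rewrite -(wintZ hq ms (fun x _ => semicircle_bound hq x)) /wint /Rintegral.
congr fine; apply: eq_integral => x _; congr EFin.
by rewrite hornerZ hornerM /weightN; ring.
Qed.

End Weight.

Section Moments.
Context {R : realType}.
Variable q : R.
Hypothesis hq : -1 < q < 1.
Local Notation mu := lebesgue_measure.

Let S := wint q (semicircle q).

Let ms : measurable_fun (Sq q) (semicircle q).
Proof.
by apply: measurable_funTS; apply: continuous_measurable_fun; exact: continuous_semicircle.
Qed.

Let SD p r : S (p + r) = S p + S r.
Proof. exact: (wintD hq ms (fun x _ => semicircle_bound hq x)). Qed.

Let SZ a p : S (a *: p) = a * S p.
Proof. exact: (wintZ hq ms (fun x _ => semicircle_bound hq x)). Qed.

Let S_cheb n : S (cheb n) = (n == 0%N)%:R.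
Proof. by rewrite /S /wint /Rintegral semicircle_cheb. Qed.

Let m N k := S (weight_poly q N * cheb k).

Let m0 k : m 0 k = (k == 0%N)%:R.
Proof. by rewrite /m /weight_poly big_nil mul1r S_cheb. Qed.

Let mS N p : S (weight_poly q N.+1 * p) = S (weight_poly q N * (lq_poly (q ^+ N.+1) * p)).
Proof. by rewrite /weight_poly big_nat_recr//= mulrA. Qed.

(* The recurrence of the moments in [N] is multiplication by one more factor
   [lq_poly]; near [k = 0] it changes form because [U_(-1) = 0]. *)
Let X2_cheb k : 'X * 'X * cheb k.+2 = cheb k.+4 + cheb k.+2 *+ 2 + cheb k :> {poly R}.
Proof. by rewrite -mulrA mulX_cheb mulrDr !mulX_cheb; ring. Qed.

Let mSS N k (Q := q ^+ N.+1) :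
  m N.+1 k.+2 = (1 + Q ^+ 2) * m N k.+2 - Q * (m N k.+4 + m N k).
Proof.
rewrite /m mS -/Q.
have -> : lq_poly Q * cheb k.+2 = (1 + Q ^+ 2) *: cheb k.+2 + (- Q) *: (cheb k.+4 + cheb k).
  rewrite /lq_poly mulrBl -scalerAl X2_cheb mul_polyC.
  by rewrite -!mul_polyC !(polyCD, polyCN, polyC_exp, polyC1); ring.
by rewrite mulrDr -!scalerAr SD !SZ (mulrDr _ (cheb k.+4)) SD; ring.
Qed.

Let mS0 N (Q := q ^+ N.+1) : m N.+1 0 = (1 + Q + Q ^+ 2) * m N 0 - Q * m N 2.
Proof.
rewrite /m mS -/Q.
have -> : lq_poly Q * cheb 0 = (1 + Q + Q ^+ 2) *: cheb 0 + (- Q) *: cheb 2.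
  rewrite /lq_poly chebSS /cheb /= mulr1 -!mul_polyC !(polyCD, polyCN, polyC_exp, polyC1); ring.
by rewrite mulrDr -!scalerAr SD !SZ; ring.
Qed.

Let mS1 N (Q := q ^+ N.+1) : m N.+1 1 = (1 + Q ^+ 2) * m N 1 - Q * m N 3.
Proof.
rewrite /m mS -/Q.
have -> : lq_poly Q * cheb 1 = (1 + Q ^+ 2) *: cheb 1 + (- Q) *: cheb 3.
  rewrite /lq_poly 2!chebSS /cheb /= -!mul_polyC !(polyCD, polyCN, polyC_exp, polyC1); ring.
by rewrite mulrDr -!scalerAr SD !SZ; ring.
Qed.

Let m_odd N k : m N k.*2.+1 = 0.
Proof.
elim: N k => [|N IH] k; first by rewrite m0.
case: k => [|k]; first by rewrite mS1 (IH 0) (IH 1); ring.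
by rewrite doubleS mSS -!doubleS !IH; ring.
Qed.

(** A finite form of Jacobi's triple product: up to sign and a power of [q],
    the Chebyshev moments of the weight truncated after [N] factors are the
    Gaussian binomials of [2 N + 1]. *)
Let m_even N k : m N k.*2 =
  if (k <= N)%N then
    (-1) ^+ k * q ^+ 'C(k.+1, 2) * qfact q (N.*2.+1) / (qfact q (N - k) * qfact q (N + k).+1)
  else 0.
Proof.
have e j := one_sub_qexp_neq0 hq j; have f j := qfact_neq0 hq j.
elim: N k => [|N IH] k.
  rewrite m0; case: k => [|k] //=.
  by rewrite subnn addn0 double0 bin_small// qfact0 !expr0 !mul1r mulfV.
case: k => [|k].
  rewrite double0 mS0 -double0 -[2%N]/(1.*2)%N !IH !subn0 !addn0 bin_small// binn !expr0.
  case: N {IH} => [|N].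
    rewrite /= doubleS double0 !qfactS qfact0 !exprS expr0 !mulr1.
    have := e 0; have := e 1; have := e 2; rewrite !exprS expr0 !mulr1 => e3 e2 e1.
    by field; rewrite e1 e2.
  rewrite /= subn1 /= addn1 !doubleS !qfactS.
  have fN := f N; have fN2 := f N.*2.
  have eN1 := e N; have eN2 := e N.+1; have eN3 := e N.+2.
  have Q2 : q ^+ N.*2 = q ^+ N * q ^+ N by rewrite -addnn exprD.
  rewrite !exprS in eN1 eN2 eN3 *; rewrite Q2 expr0.
  field.
  by rewrite fN eN1 eN2 eN3.
have C2 : q ^+ 'C(k.+2, 2) = q ^+ 'C(k.+1, 2) * (q * q ^+ k).
  by rewrite binS bin1 exprD exprS.
have C3 : q ^+ 'C(k.+3, 2) = q ^+ 'C(k.+1, 2) * (q * q ^+ k) * (q * (q * q ^+ k)).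
  by rewrite binS bin1 exprD C2 !exprS.
rewrite doubleS mSS -!doubleS !IH ltnS.
case: (ltngtP k N) => [kN|Nk|->] in C2 C3 *; last 2 first.
- rewrite ifF; last by lia.
  by rewrite !(mulr0, addr0, subr0).
- rewrite ifF; last by lia.
  rewrite C2 !subSS !subnn !addSn !addnS !addnn doubleS !qfactS qfact0 !exprS.
  have fN := f N.*2; have e1 := e N.*2; have e2 := e N.*2.+1. have e3 := e N.*2.+2.
  rewrite !exprS in e1 e2 e3; set P := q ^+ 'C(_, _).
  by field; rewrite fN e1 e2 e3.
(* Away from the boundary, common factors cancel and a rational identity in
   [q ^+ k] and [q ^+ d] remains. *)
case: (leqP k.+2 N) => kN2.
  have -> : N = (k.+2 + (N - k.+2))%N by lia.
  set d := (N - k.+2)%N.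
  have -> : (k.+2 + d - k.+1 = d.+1)%N by lia.
  have -> : (k.+2 + d - k.+2 = d)%N by lia.
  have -> : (k.+2 + d - k = d.+2)%N by lia.
  have -> : ((k.+2 + d).+1 - k.+1 = d.+2)%N by lia.
  have -> : ((k.+2 + d).*2.+1 = (k.*2 + d.*2).+2.+3)%N by lia.
  have -> : ((k.+2 + d).+1.*2.+1 = (k.*2 + d.*2).+2.+3.+2)%N by lia.
  have -> : ((k.+2 + d + k.+1).+1 = (k.*2 + d).+4)%N by lia.
  have -> : ((k.+2 + d + k.+2).+1 = (k.*2 + d).+2.+3)%N by lia.
  have -> : ((k.+2 + d + k).+1 = (k.*2 + d).+3)%N by lia.
  have -> : (((k.+2 + d).+1 + k.+1).+1 = (k.*2 + d).+2.+3)%N by lia.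
  rewrite C2 C3 !qfactS.
  have f1 := f (k.*2 + d)%N; have f2 := f d.
  have e1 := e d; have e2 := e d.+1.
  have e3 := e (k.*2 + d)%N; have e4 := e (k.*2 + d).+1; have e5 := e (k.*2 + d).+2.
  have e6 := e (k.*2 + d).+3; have e7 := e (k.*2 + d).+4.
  rewrite (_ : (k.+2 + d).+1 = (k + d).+3)%N; last by lia.
  rewrite !exprS in e1 e2 e3 e4 e5 e6 e7 *.
  rewrite !exprD -!addnn !exprD in e1 e2 e3 e4 e5 e6 e7 *.
  set P := q ^+ 'C(_, _); set K := q ^+ k; set D := q ^+ d; set s := (-1) ^+ k.
  rewrite -addnn in f1.
  by field; rewrite f1 f2 e1 e2 e3 e4 e5 e6 e7.
have -> : N = k.+1 by lia.
have -> : (k.+1 - k.+1 = 0)%N by lia.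
have -> : (k.+1 - k = 1)%N by lia.
have -> : (k.+2 - k.+1 = 1)%N by lia.
have -> : (k.+1 + k.+1).+1 = k.*2.+3 by lia.
have -> : (k.+1 + k).+1 = k.*2.+2 by lia.
have -> : (k.+2 + k.+1).+1 = k.*2.+4 by lia.
rewrite C2 !doubleS !qfactS qfact0.
have fk := f k.*2; have e1 := e k.*2; have e2 := e k.*2.+1; have e3 := e k.*2.+2.
have e4 := e k.*2.+3; have e5 := e 0.
rewrite !exprS expr0 ?mulr1 in e1 e2 e3 e4 e5 *.
rewrite -!addnn !exprD in e1 e2 e3 e4 *.
set P := q ^+ 'C(_, _); set K := q ^+ k; set s := (-1) ^+ k.
rewrite -addnn in fk.
by field; rewrite fk e1 e2 e3 e4 e5.
Qed.

Let L := wint q (fN q).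

Let L_odd k : L (cheb k.*2.+1) = 0.
Proof.
apply/esym; have h := @wint_fN_cvg _ _ hq (cheb k.*2.+1).
rewrite -[RHS](cvg_lim _ h)//; apply/esym/cvg_lim => //.
by under eq_fun do rewrite -[wint _ _ _]/(m _ _) m_odd mulr0; exact: cvg_cst.
Qed.

Let L_even k : L (cheb k.*2) = (-1) ^+ k * q ^+ 'C(k.+1, 2).
Proof.
have h := @wint_fN_cvg _ _ hq (cheb k.*2).
rewrite /L -(cvg_lim _ h)//; apply/cvg_lim => //.
have q1 : `|q| < 1 by rewrite ltr_norml.
have p0 := qpoch_neq0 hq q1.
have qc (g : nat -> nat) : g n @[n --> \oo] --> \oo ->
    qfact q (g n) @[n --> \oo] --> qpoch q q.
  by move=> gc; exact: (cvg_comp g _ gc (@qpoch_cvg _ _ hq q)).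
have c1 : qfact q N.*2.+1 @[N --> \oo] --> qpoch q q.
  apply: qc; rewrite (_ : (fun n => _) = (fun n => n * 2 + 1)%N); last first.
    by apply/funext => n; lia.
  exact: (cvg_comp (fun n => n * 2)%N (fun n => n + 1)%N (@cvg_mulnr 2 isT) (@cvg_addnr 1)).
have c2 : qfact q (N - k) @[N --> \oo] --> qpoch q q by apply: qc; exact: cvg_subnr.
have c3 : qfact q (N + k).+1 @[N --> \oo] --> qpoch q q.
  apply: qc; under eq_fun do rewrite -addnS; exact: cvg_addnr.
have E : (-1) ^+ k * q ^+ 'C(k.+1, 2) =
   qpoch q q * ((-1) ^+ k * q ^+ 'C(k.+1, 2) * qpoch q q / (qpoch q q * qpoch q q)).
  by set P := q ^+ 'C(_, _); field.
rewrite E.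
have H : qpoch q q * ((-1) ^+ k * q ^+ 'C(k.+1, 2) * qfact q N.*2.+1 /
      (qfact q (N - k) * qfact q (N + k).+1)) @[N --> \oo] -->
   qpoch q q * ((-1) ^+ k * q ^+ 'C(k.+1, 2) * qpoch q q / (qpoch q q * qpoch q q)).
  apply: cvgMr; apply: cvgM; first exact: cvgMr.
  by apply: cvgV; [exact: mulf_neq0|exact: cvgM].
apply: cvg_trans H; apply: near_eq_cvg; near=> N.
by rewrite -[wint _ _ _]/(m _ _) m_even ifT//; near: N; exact: nbhs_infty_ge.
Unshelve. all: by end_near. Qed.

Theorem fN_orthogonal k n :
  wint q (fN q) (hermite q k * hermite q n) = (k == n)%:R * qfact q n.
Proof.
have [B _ hB] := fN_bound hq.
apply: (@hermite_orthogonal _ q hq L).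
- by move=> p r; exact: (wintD hq (measurable_fN hq) hB).
- by move=> a p; exact: (wintZ hq (measurable_fN hq) hB).
- exact: L_even.
- exact: L_odd.
Qed.

End Moments.

(** * The Chapman-Kolmogorov and trace identities *)

Section Kernel.
Context {R : realType}.
Variable q : R.
Hypothesis hq : -1 < q < 1.
Local Notation mu := lebesgue_measure.
Let orthogonal := fN_orthogonal hq.

(** Polynomial in [t], so that orthogonality applies to the partial sums of
    [mehler rho t s]. *)
Definition mehler_poly rho s N : {poly R} :=
  \sum_(0 <= i < N) ((hermite q i).[s] / qfact q i * rho ^+ i) *: hermite q i.

Lemma mehler_polyE rho s N t : (mehler_poly rho s N).[t] = mehler_sum q rho t s N.
Proof.
rewrite /mehler_poly horner_sum /mehler_sum seriesEnat /=; apply: eq_bigr => i _.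
by rewrite hornerZ /mehler_coef; ring.
Qed.

Lemma mehler_sumC rho t s N : mehler_sum q rho t s N = mehler_sum q rho s t N.
Proof.
by rewrite /mehler_sum !seriesEnat /=; apply: eq_bigr => i _; rewrite /mehler_coef; ring.
Qed.

Lemma mehlerC rho t s : mehler q rho t s = mehler q rho s t.
Proof. by rewrite /mehler; congr (limn _); apply/funext => N; rewrite mehler_sumC. Qed.

Lemma mehler_sum_bound rho : `|rho| < 1 -> exists2 M, 0 <= M &
  forall N t s, `|t| <= 2 -> `|s| <= 2 -> `|mehler_sum q rho t s N| <= M.
Proof.
move=> hr; have [K [a [K0 ha hK]]] := mehler_term_bound hq hr.
exists (K / (1 - a)); first by rewrite divr_ge0// subr_ge0 ltW//; case/andP: ha.
by move=> N t s ht hs; apply: (geom_series_bound _ ha) => i; exact: hK.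
Qed.

Let LD p r : wint q (fN q) (p + r) = wint q (fN q) p + wint q (fN q) r.
Proof. by have [B _ hB] := fN_bound hq; exact: (wintD hq (measurable_fN hq) hB). Qed.

Let LZ a p : wint q (fN q) (a *: p) = a * wint q (fN q) p.
Proof. by have [B _ hB] := fN_bound hq; exact: (wintZ hq (measurable_fN hq) hB). Qed.

Let Lsum N (F : nat -> {poly R}) : wint q (fN q) (\sum_(0 <= i < N) F i) =
  \sum_(0 <= i < N) wint q (fN q) (F i).
Proof.
elim: N => [|N IH]; last by rewrite !big_nat_recr//= LD IH.
by rewrite !big_nil -(scale0r 0) LZ mul0r.
Qed.

Let L_mpoly rho sigma s u N :
  wint q (fN q) (mehler_poly rho s N * mehler_poly sigma u N) = mehler_sum q (rho * sigma) s u N.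
Proof.
rewrite {1}/mehler_poly big_distrl /= Lsum /mehler_sum seriesEnat /=.
apply: eq_big_nat => i /andP[_ iN]; rewrite /mehler_poly big_distrr /= Lsum.
have qi := qfact_neq0 hq i.
rewrite big_mkord (bigD1 (Ordinal iN))//= big1 ?addr0 => [|j ji].
  rewrite -scalerAl -scalerAr !LZ orthogonal eqxx /mehler_coef exprMn /= mul1r.
  by field.
rewrite -scalerAl -scalerAr !LZ orthogonal (_ : (i == j) = false) ?mul0r ?mulr0//.
by apply/negbTE; rewrite eq_sym.
Qed.

Lemma bounded_integral_lim (f_ : nat -> R -> R) (f : R -> R) (u : nat -> R) (l M : R) :
  (forall n, measurable_fun (Sq q) (f_ n)) ->
  (forall n x, Sq q x -> `|f_ n x| <= M) ->
  (forall x, Sq q x -> f_ n x @[n --> \oo] --> f x) ->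
  (forall n, (\int[mu]_(x in Sq q) (f_ n x)%:E = (u n)%:E)%E) ->
  u @ \oo --> l ->
  mu.-integrable (Sq q) (EFin \o f) /\ (\int[mu]_(x in Sq q) (f x)%:E = l%:E)%E.
Proof.
move=> mf fM fc fu ul; split.
  apply: (@Sq_bounded_integrable _ q f M); first exact: measurable_fun_cvg mf fc.
  by move=> x Sx; apply: cvg_le_norm (fc x Sx) _ => n; exact: fM.
have h := Sq_bounded_cvg mf fM fc.
rewrite -(cvg_lim _ h)//; apply/cvg_lim => //.
by under eq_fun do rewrite fu; apply: cvg_EFin => //; exact: nearW.
Qed.

(** The Chapman-Kolmogorov identity: by orthogonality it holds exactly between
    partial sums, which are bounded uniformly on the support. *)
Lemma mehler_convolution rho sigma s u : `|rho| < 1 -> `|sigma| < 1 ->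
  `|s| <= 2 -> `|u| <= 2 ->
  let f x := fN q x * mehler q rho (rescale q x) s * mehler q sigma (rescale q x) u in
  mu.-integrable (Sq q) (EFin \o f) /\
  (\int[mu]_(x in Sq q) (f x)%:E = (mehler q (rho * sigma) s u)%:E)%E.
Proof.
move=> hr hsg hs hu f; have [B B0 hB] := fN_bound hq.
have [M M0 hM] := mehler_sum_bound hr; have [M' M0' hM'] := mehler_sum_bound hsg.
have hrs : `|rho * sigma| < 1.
  by rewrite normrM mulr_ilt1.
apply: (@bounded_integral_lim
  (fun N x => fN q x * (mehler_poly rho s N * mehler_poly sigma u N).[rescale q x]) _
  (mehler_sum q (rho * sigma) s u) _ (B * (M * M'))).
- move=> N; apply: measurable_funM; first exact: measurable_fN.
  exact: measurable_poly_rescale.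
- move=> N x Sx; rewrite hornerM !mehler_polyE normrM; apply: ler_pM => //; first exact: hB.
  by rewrite normrM ler_pM ?hM ?hM' ?rescale_le2.
- move=> x Sx; have hx := rescale_le2 hq Sx.
  rewrite /f -mulrA; apply: cvgMr; under eq_fun do rewrite hornerM !mehler_polyE.
  by apply: cvgM; exact: mehler_sum_cvg.
- by move=> N; rewrite (wintE hq (measurable_fN hq) hB) L_mpoly.
- exact: mehler_sum_cvg.
Qed.

(** Each term [r^n H_n^2 / (q)_n] integrates to [r^n]. *)
Lemma mehler_trace r : `|r| < 1 ->
  let f x := fN q x * mehler q r (rescale q x) (rescale q x) in
  mu.-integrable (Sq q) (EFin \o f) /\
  (\int[mu]_(x in Sq q) (f x)%:E = ((1 - r)^-1)%:E)%E.
Proof.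
move=> hr f; have [B B0 hB] := fN_bound hq; have [M M0 hM] := mehler_sum_bound hr.
pose p N : {poly R} := \sum_(0 <= i < N) (r ^+ i / qfact q i) *: (hermite q i * hermite q i).
have pE N t : (p N).[t] = mehler_sum q r t t N.
  rewrite /p horner_sum /mehler_sum seriesEnat /=; apply: eq_bigr => i _.
  by rewrite hornerZ hornerM /mehler_coef; ring.
apply: (@bounded_integral_lim (fun N x => fN q x * (p N).[rescale q x]) _
  (series (geometric 1 r)) _ (B * M)).
- move=> N; apply: measurable_funM; first exact: measurable_fN.
  exact: measurable_poly_rescale.
- move=> N x Sx; rewrite pE normrM; apply: ler_pM => //; first exact: hB.
  by rewrite hM ?rescale_le2.
- move=> x Sx; have hx := rescale_le2 hq Sx.
  by apply: cvgMr; under eq_fun do rewrite pE; exact: mehler_sum_cvg.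
- move=> N; rewrite (wintE hq (measurable_fN hq) hB); congr EFin.
  rewrite Lsum seriesEnat /=; apply: eq_bigr => i _.
  rewrite LZ orthogonal eqxx !mul1r mulfVK// qfact_neq0//.
- by rewrite -[_^-1]mul1r; exact: cvg_geometric_series.
Qed.

End Kernel.

(** * The three-dimensional density *)

Section Tonelli.
Context d1 d2 {T1 : measurableType d1} {T2 : measurableType d2} {R : realType}.
Variables (m1 : {sigma_finite_measure set T1 -> \bar R})
          (m2 : {sigma_finite_measure set T2 -> \bar R}).

Lemma tonelli_setX (A : set T1) (B : set T2) (f : T1 * T2 -> \bar R) :
  measurable A -> measurable B -> measurable_fun (A `*` B) f ->
  (forall p, (A `*` B) p -> 0 <= f p)%E ->
  (\int[m1 \x m2]_(p in A `*` B) f p =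
   \int[m1]_(x in A) \int[m2]_(y in B) f (x, y))%E.
Proof.
move=> mA mB mf f0; have mAB := measurableX mA mB.
rewrite integral_mkcond fubini_tonelli1; first last.
- by move=> p; rewrite patchE; case: ifPn => // /set_mem; exact: f0.
- by apply/(measurable_restrict _ mAB measurableT); rewrite setTI.
rewrite [RHS]integral_mkcond; apply: eq_integral => x _; rewrite /fubini_F patchE.
case: ifPn => [/set_mem Ax|/negP Ax].
  rewrite [RHS]integral_mkcond; apply: eq_integral => y _; rewrite !patchE.
  congr (if _ then _ else _); apply/idP/idP => /set_mem h; apply/mem_set => //.
  by case: h.
rewrite (_ : point = 0%E)//; apply: integral0_eq => y _; rewrite patchE.
by case: ifPn => // /set_mem [/= Ax' _]; exfalso; apply: Ax; exact/mem_set.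
Qed.

End Tonelli.

Section ProductMeasure.
Context d1 d2 (T1 : measurableType d1) (T2 : measurableType d2) (R : realType).
Variables (m1 : {sigma_finite_measure set T1 -> \bar R})
          (m2 : {sigma_finite_measure set T2 -> \bar R}).

(** A named copy of the product measure, to carry its sigma-finiteness into
    iterated products. *)
Definition prod_measure : set (T1 * T2) -> \bar R := (m1 \x m2)%E.

HB.instance Definition _ := Measure.copy prod_measure (m1 \x m2)%E.

Lemma prod_measure_sigma_finite : sigma_finite setT prod_measure.
Proof.
have /sigma_finiteP[F [FT ndF hF]] := sigma_finiteT m1.
have /sigma_finiteP[G [GT ndG hG]] := sigma_finiteT m2.
exists (fun n => F n `*` G n) => [|n].
  apply/esym; rewrite -subTset => -[x y] _.
  have [i _ Fx] : (\bigcup_i F i) x by rewrite -FT.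
  have [j _ Gy] : (\bigcup_j G j) y by rewrite -GT.
  exists (maxn i j) => //; split=> /=.
    by have /subsetPset := ndF _ _ (leq_maxl i j); exact.
  by have /subsetPset := ndG _ _ (leq_maxr i j); exact.
have [[mF Fn] [mG Gn]] := (hF n, hG n); split; first exact: measurableX.
rewrite /prod_measure product_measure1E//.
by rewrite lte_mul_pinfty// ge0_fin_numE.
Qed.

HB.instance Definition _ := Measure_isSigmaFinite.Build _ _ _ prod_measure
  prod_measure_sigma_finite.

End ProductMeasure.

Section Tonelli3.
Context d1 d2 d3 {T1 : measurableType d1} {T2 : measurableType d2}
        {T3 : measurableType d3} {R : realType}.
Variables (m1 : {sigma_finite_measure set T1 -> \bar R})
          (m2 : {sigma_finite_measure set T2 -> \bar R})
          (m3 : {sigma_finite_measure set T3 -> \bar R}).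

Lemma tonelli_setX3 (A : set T1) (B : set T2) (C : set T3) (f : T1 * T2 * T3 -> \bar R) :
  measurable A -> measurable B -> measurable C ->
  measurable_fun ((A `*` B) `*` C) f ->
  (forall p, ((A `*` B) `*` C) p -> 0 <= f p)%E ->
  (\int[(m1 \x m2) \x m3]_(p in (A `*` B) `*` C) f p =
   \int[m1 \x m2]_(x in A `*` B) \int[m3]_(z in C) f (x, z))%E.
Proof.
move=> mA mB mC mf f0; have mAB := measurableX mA mB.
exact: (tonelli_setX (prod_measure m1 m2) m3 mAB mC mf f0).
Qed.
End Tonelli3.

Section Density.
Context {R : realType}.
Variable q : R.
Hypothesis hq : -1 < q < 1.
Local Notation mu := lebesgue_measure.
Local Notation M r x y := (mehler q r (rescale q x) (rescale q y)).

Let q01 : 0 <= `|q| < 1. Proof. by rewrite normr_ge0 ltr_norml. Qed.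

Lemma omegaqE x y rho : omegaq q x y rho = omega_scaled (rescale q x) (rescale q y) rho.
Proof.
have kk : rescale q x * rescale q y = (1 - q) * (x * y).
  rewrite /rescale mulrACA -expr2 sqr_sqrtr// subr_ge0 ltW//; by case/andP: hq.
by rewrite /omegaq /omega_scaled kk !rescale_sqr//; ring.
Qed.

Let omegaq_seqE x y rho : (fun i => omegaq q x y (rho * q ^+ i)) =
  (fun i => omega_scaled (rescale q x) (rescale q y) (rho * q ^+ i)).
Proof. by apply/funext => i; rewrite omegaqE. Qed.

Lemma omegaq_cvg x y rho : `|rho| < 1 -> Sq q x -> Sq q y ->
  \prod_(0 <= i < n) omegaq q x y (rho * q ^+ i) @[n --> \oo]
  --> iprod (fun i => omegaq q x y (rho * q ^+ i)).
Proof.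
move=> hr Sx Sy; rewrite omegaq_seqE; under eq_fun do under eq_bigr do rewrite omegaqE.
by apply: omega_scaled_cvg => //; exact: rescale_le2.
Qed.

Lemma mehler_omegaq x y rho : `|rho| < 1 -> Sq q x -> Sq q y ->
  M rho x y = qpoch q (rho ^+ 2) / iprod (fun i => omegaq q x y (rho * q ^+ i)).
Proof. by move=> hr Sx Sy; rewrite omegaq_seqE mehlerE// rescale_le2. Qed.

Lemma f3D_constE C r12 r13 r23 x y z : `|r12| < 1 -> `|r13| < 1 -> `|r23| < 1 ->
  Sq q x -> Sq q y -> Sq q z ->
  f3D_const C q r12 r13 r23 x y z =
  C * (fN q x * fN q y * fN q z * (M r12 x y * M r13 x z * M r23 y z)).
Proof.
move=> h12 h13 h23 Sx Sy Sz; rewrite /f3D_const.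
rewrite (iprodE (iprodM (iprodM (omegaq_cvg h12 Sx Sy) (omegaq_cvg h13 Sx Sz))
  (omegaq_cvg h23 Sy Sz))) !mehler_omegaq// !invfM; ring.
Qed.

(** On the diagonal [omegaq q x x r = (1 - r) ^+ 2 * lq q x r], which turns the
    Mehler kernel into the weight of the Rogers density. *)
Lemma fR_mehler x r : `|r| < 1 -> Sq q x -> fR q x r = (1 - r) * (fN q x * M r x x).
Proof.
move=> hr Sx; rewrite mehler_omegaq// /fR.
have r1 : 1 - r != 0.
  by rewrite subr_eq0 eq_sym lt_eqF//; apply: le_lt_trans (ler_norm _) hr.
have -> : iprod (fun i => omegaq q x x (r * q ^+ i)) =
    qpoch q r * qpoch q r * iprod (fun i => lq q x (r * q ^+ i)).
  have cl := iprod_cvg (ler0n _ 7) q01 (fun i => lq_factor hq i (ltW hr) Sx).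
  have cp := @qpoch_cvg _ q hq r.
  rewrite -(iprodE (iprodM (iprodM cp cp) cl)); congr iprod; apply/funext => i.
  by rewrite /omegaq /lq; ring.
set P := qpoch q r; set l := iprod _.
have -> : P * P = (1 - r) * (P * qpoch q (r * q)) by rewrite {2}/P (qpochS hq); ring.
rewrite -(mulrA (1 - r)) (invfM (1 - r)); set Z := (_ * l)^-1.
by field.
Qed.

Lemma mehler_convolution_integral c (g : R -> R) rho sigma a b :
  `|rho| < 1 -> `|sigma| < 1 -> Sq q a -> Sq q b ->
  (forall x, Sq q x -> g x = c * (fN q x * M rho x a * M sigma x b)) ->
  (\int[mu]_(x in Sq q) (g x)%:E = (c * M (rho * sigma) a b)%:E)%E.
Proof.
move=> hr hs Sa Sb gE.
have [fi fE] := mehler_convolution hq hr hs (rescale_le2 hq Sa) (rescale_le2 hq Sb).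
rewrite EFinM -fE -integralZl//; last exact: measurable_Sq.
by apply: eq_integral => x /set_mem Sx; rewrite gE// EFinM.
Qed.

Lemma mehler_trace_integral c (g : R -> R) r : `|r| < 1 ->
  (forall x, Sq q x -> g x = c * (fN q x * M r x x)) ->
  (\int[mu]_(x in Sq q) (g x)%:E = (c / (1 - r))%:E)%E.
Proof.
move=> hr gE; have [fi fE] := mehler_trace hq hr.
rewrite EFinM -fE -integralZl//; last exact: measurable_Sq.
by apply: eq_integral => x /set_mem Sx; rewrite gE// EFinM.
Qed.

Section OneVariable.
Variables r12 r13 r23 : R.
Hypotheses (h12 : `|r12| < 1) (h13 : `|r13| < 1) (h23 : `|r23| < 1).

Lemma f3D_integral_x C y z : Sq q y -> Sq q z ->
  (\int[mu]_(x in Sq q) (f3D_const C q r12 r13 r23 x y z)%:E =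
   (C * fN q y * fN q z * M r23 y z * M (r12 * r13) y z)%:E)%E.
Proof.
move=> Sy Sz; apply: mehler_convolution_integral => // x Sx.
by rewrite f3D_constE//; ring.
Qed.

Lemma f3D_integral_y C x z : Sq q x -> Sq q z ->
  (\int[mu]_(y in Sq q) (f3D_const C q r12 r13 r23 x y z)%:E =
   (C * fN q x * fN q z * M r13 x z * M (r12 * r23) x z)%:E)%E.
Proof.
move=> Sx Sz; apply: mehler_convolution_integral => // y Sy.
by rewrite f3D_constE// (mehlerC _ r12); ring.
Qed.

Lemma f3D_integral_z C x y : Sq q x -> Sq q y ->
  (\int[mu]_(z in Sq q) (f3D_const C q r12 r13 r23 x y z)%:E =
   (C * fN q x * fN q y * M r12 x y * M (r13 * r23) x y)%:E)%E.
Proof.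
move=> Sx Sy; apply: mehler_convolution_integral => // z Sz.
by rewrite f3D_constE// (mehlerC _ r13) (mehlerC _ r23); ring.
Qed.

End OneVariable.

Lemma fN_measurable_comp d (T : measurableType d) (D : set T) (u : T -> R) :
  measurable_fun setT u -> (forall p, D p -> Sq q (u p)) ->
  measurable_fun D (fun p => fN q (u p)).
Proof.
move=> mu_ Du; apply: (@measurable_fun_cvg _ _ _ _ (fun N p => weightN q N (u p))).
  move=> N; apply: measurable_funTS; apply: (measurableT_comp _ mu_).
  apply: measurable_funM.
    apply: measurable_funM => //.
    by apply: continuous_measurable_fun; exact: continuous_semicircle.
  by apply: continuous_measurable_fun; exact: continuous_poly_rescale.
by move=> p /Du; exact: weightN_cvg.
Qed.

Lemma mehler_measurable_comp d (T : measurableType d) (D : set T) (u v : T -> R) r :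
  `|r| < 1 -> measurable_fun setT u -> measurable_fun setT v ->
  (forall p, D p -> Sq q (u p) /\ Sq q (v p)) ->
  measurable_fun D (fun p => M r (u p) (v p)).
Proof.
move=> hr mu_ mv Duv.
have mp (p : {poly R}) (w : T -> R) : measurable_fun setT w ->
    measurable_fun setT (fun z => p.[rescale q (w z)]).
  move=> mw; apply: (@measurableT_comp _ _ _ _ _ _ (fun x => p.[rescale q x])) => //.
  by apply: continuous_measurable_fun; exact: continuous_poly_rescale.
apply: (@measurable_fun_cvg _ _ _ _
  (fun N p => mehler_sum q r (rescale q (u p)) (rescale q (v p)) N)).
  move=> N; apply: measurable_funTS; rewrite /mehler_sum.
  under eq_fun do rewrite seriesEnat /=.
  apply: measurable_sum => i; apply: measurable_funM => //.
  by apply: measurable_funM => //; apply: measurable_funM; exact: mp.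
by move=> p /Duv[Su Sv]; apply: mehler_sum_cvg => //; exact: rescale_le2.
Qed.

Lemma norm_mul_lt1 (a b : R) : `|a| < 1 -> `|b| < 1 -> `|a * b| < 1.
Proof. by move=> ha hb; rewrite normrM mulr_ilt1. Qed.

Lemma mehler_rescale_ge0 rho x y : `|rho| < 1 -> Sq q x -> Sq q y -> 0 <= M rho x y.
Proof. by move=> hr Sx Sy; apply: mehler_ge0 => //; exact: rescale_le2. Qed.

Section Normalization.
Variables r12 r13 r23 : R.
Hypotheses (h12 : `|r12| < 1) (h13 : `|r13| < 1) (h23 : `|r23| < 1).
Local Notation T := (measurableTypeR R).
Local Notation S2 := (Sq q `*` Sq q : set (T * T)).
Local Notation S3 := (S2 `*` Sq q : set (T * T * T)).
Local Notation h := (fun p : T * T * T => f3D_const 1 q r12 r13 r23 p.1.1 p.1.2 p.2).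

Let mfst2 : measurable_fun [set: T * T * T] (fun p : T * T * T => p.1.1).
Proof. exact: (measurableT_comp measurable_fst measurable_fst). Qed.

Let msnd2 : measurable_fun [set: T * T * T] (fun p : T * T * T => p.1.2).
Proof. exact: (measurableT_comp measurable_snd measurable_fst). Qed.

Let mS1 : measurable (Sq q : set T).
Proof. exact: measurable_Sq. Qed.

Let mS2 : measurable S2.
Proof. by exact: measurableX. Qed.

Let measurable_density : measurable_fun S3 (EFin \o h).
Proof.
apply/measurable_EFinP; apply: (@eq_measurable_fun _ _ _ _ _ (fun p =>
  fN q p.1.1 * fN q p.1.2 * fN q p.2 *
  (M r12 p.1.1 p.1.2 * M r13 p.1.1 p.2 * M r23 p.1.2 p.2))).
  by move=> p /set_mem [[/= Sx Sy] Sz]; rewrite f3D_constE// mul1r.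
apply: measurable_funM.
  by apply: measurable_funM; [apply: measurable_funM|];
    apply: fN_measurable_comp => // p [[]].
by apply: measurable_funM; [apply: measurable_funM|];
  apply: mehler_measurable_comp => // p [[]].
Qed.

Let density_ge0 p : S3 p -> 0 <= h p.
Proof.
move=> [[/= Sx Sy] Sz]; rewrite f3D_constE// mul1r.
by repeat first [exact: fN_ge0 | exact: mehler_rescale_ge0 | apply: mulr_ge0].
Qed.

(** Integrating in the order [z], [y], [x] merges two kernels, then two more into
    a loop, and then takes its trace. *)
Let density_mass :
  (\int[(lebesgue_measure \x lebesgue_measure) \x lebesgue_measure]_(p in S3) (h p)%:E =
   ((1 - r12 * r13 * r23)^-1)%:E)%E.
Proof.
rewrite (tonelli_setX3 _ _ _ mS1 mS1 mS1 measurable_density); last first.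
  by move=> p Sp; rewrite lee_fin; exact: density_ge0.
pose g (p : T * T) := 1 * fN q p.1 * fN q p.2 * M r12 p.1 p.2 * M (r13 * r23) p.1 p.2.
have hp := norm_mul_lt1 h13 h23.
transitivity (\int[lebesgue_measure \x lebesgue_measure]_(p in S2) (g p)%:E)%E.
  by apply: eq_integral => -[x y] /set_mem [/= Sx Sy]; rewrite f3D_integral_z.
have mg : measurable_fun S2 (EFin \o g).
  apply/measurable_EFinP; rewrite /g.
  apply: measurable_funM; last by apply: mehler_measurable_comp => // p [].
  apply: measurable_funM; last by apply: mehler_measurable_comp => // p [].
  apply: measurable_funM; last by apply: fN_measurable_comp => // p [].
  by apply: measurable_funM => //; apply: fN_measurable_comp => // p [].
rewrite (tonelli_setX _ _ mS1 mS1 mg); last first.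
  move=> p [/= Sx Sy]; rewrite lee_fin /g mul1r.
  by repeat first [exact: fN_ge0 | exact: mehler_rescale_ge0 | apply: mulr_ge0].
transitivity (\int[mu]_(x in Sq q) (fN q x * M (r12 * (r13 * r23)) x x)%:E)%E.
  apply: eq_integral => x /set_mem Sx.
  rewrite (@mehler_convolution_integral (fN q x) _ r12 (r13 * r23) x x)// => y Sy.
  by rewrite /g /= (mehlerC _ r12) (mehlerC _ (r13 * r23)); ring.
rewrite (@mehler_trace_integral 1 _ (r12 * (r13 * r23)))//.
- by rewrite div1r mulrA.
- exact: norm_mul_lt1.
- by move=> x _; rewrite mul1r.
Qed.

Lemma C3D_value : C3D q r12 r13 r23 = 1 - r12 * r13 * r23.
Proof.
have hr : 1 - r12 * r13 * r23 != 0.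
  rewrite subr_eq0 eq_sym lt_eqF//; apply: le_lt_trans (ler_norm _) _.
  by rewrite norm_mul_lt1// norm_mul_lt1.
have mS3 : measurable S3 by exact: measurableX.
have ih : ((lebesgue_measure \x lebesgue_measure) \x lebesgue_measure)%E.-integrable
    S3 (EFin \o h).
  apply/integrableP; split=> //.
  under eq_integral => p /set_mem Sp do rewrite gee0_abs ?lee_fin ?density_ge0//.
  by rewrite density_mass ltry.
have mass C : (\int[(lebesgue_measure \x lebesgue_measure) \x lebesgue_measure]_(p in S3)
   (f3D_const C q r12 r13 r23 p.1.1 p.1.2 p.2)%:E = (C / (1 - r12 * r13 * r23))%:E)%E.
  rewrite EFinM -density_mass -integralZl//; apply: eq_integral => p /set_mem [[Sx Sy] Sz].
  by rewrite -EFinM !f3D_constE// mul1r.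
rewrite /C3D; apply: xget_unique => [|C] /=; rewrite mass; first by rewrite divff.
by move=> [] /divr1_eq.
Qed.

End Normalization.

Section Marginals.
Variables r12 r13 r23 : R.
Hypotheses (h12 : `|r12| < 1) (h13 : `|r13| < 1) (h23 : `|r23| < 1).
Let r := r12 * r13 * r23.

Lemma fYZ_mehler y z : Sq q y -> Sq q z ->
  fYZ q r12 r13 r23 y z = (1 - r) * fN q y * fN q z * M r23 y z * M (r12 * r13) y z.
Proof. by move=> Sy Sz; rewrite /fYZ /f3D C3D_value// /Rintegral f3D_integral_x. Qed.

Lemma fXZ_mehler x z : Sq q x -> Sq q z ->
  fXZ q r12 r13 r23 x z = (1 - r) * fN q x * fN q z * M r13 x z * M (r12 * r23) x z.
Proof. by move=> Sx Sz; rewrite /fXZ /f3D C3D_value// /Rintegral f3D_integral_y. Qed.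

Lemma fXY_mehler x y : Sq q x -> Sq q y ->
  fXY q r12 r13 r23 x y = (1 - r) * fN q x * fN q y * M r12 x y * M (r13 * r23) x y.
Proof. by move=> Sx Sy; rewrite /fXY /f3D C3D_value// /Rintegral f3D_integral_z. Qed.

(** A one-dimensional marginal is a loop of two Mehler kernels from a point back
    to itself. *)
Let marginal_fR (g : R -> R) rho sigma x : `|rho| < 1 -> `|sigma| < 1 ->
  rho * sigma = r -> Sq q x ->
  (forall y, Sq q y -> g y = (1 - r) * fN q x * fN q y * M rho y x * M sigma y x) ->
  \int[mu]_(y in Sq q) g y = fR q x r.
Proof.
move=> hr hs rE Sx gE; rewrite fR_mehler// -?rE; last exact: norm_mul_lt1.
rewrite /Rintegral (@mehler_convolution_integral ((1 - r) * fN q x) _ rho sigma x x)//.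
  by rewrite /= -rE -mulrA.
by move=> y Sy; rewrite gE//; ring.
Qed.

Lemma fX_fR x : Sq q x -> fX q r12 r13 r23 x = fR q x r.
Proof.
move=> Sx; apply: (@marginal_fR _ r13 (r12 * r23)) => //; first exact: norm_mul_lt1.
  by rewrite /r; ring.
move=> z Sz; rewrite -[LHS]/(fXZ q r12 r13 r23 x z) fXZ_mehler//.
by rewrite (mehlerC _ r13) (mehlerC _ (r12 * r23)).
Qed.

Lemma fY_fR y : Sq q y -> fY q r12 r13 r23 y = fR q y r.
Proof.
move=> Sy; apply: (@marginal_fR _ r23 (r12 * r13)) => //; first exact: norm_mul_lt1.
  by rewrite /r; ring.
move=> z Sz; rewrite -[LHS]/(fYZ q r12 r13 r23 y z) fYZ_mehler//.
by rewrite (mehlerC _ r23) (mehlerC _ (r12 * r13)).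
Qed.

Lemma fZ_fR z : Sq q z -> fZ q r12 r13 r23 z = fR q z r.
Proof.
move=> Sz; apply: (@marginal_fR _ r23 (r12 * r13)) => //; first exact: norm_mul_lt1.
  by rewrite /r; ring.
by move=> y Sy; rewrite -[LHS]/(fYZ q r12 r13 r23 y z) fYZ_mehler//; ring.
Qed.

End Marginals.

(** The two closed forms in which a two-dimensional marginal is displayed are
    both the product of two Mehler kernels. *)
Lemma mehler_pair_closed_form c rho sigma tau x y : `|rho| < 1 -> `|sigma| < 1 ->
  tau = sigma ^+ 2 -> Sq q x -> Sq q y ->
  c * fN q x * fN q y * M rho x y * M sigma x y =
    c * fN q x * fN q y * ((qpoch q (rho ^+ 2) * qpoch q tau)
      / iprod (fun i => omegaq q x y (rho * q ^+ i) * omegaq q x y (sigma * q ^+ i))) /\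
  c * fN q x * fN q y * M rho x y * M sigma x y = c * fCN q x y rho * fCN q y x sigma.
Proof.
move=> hr hs -> Sx Sy; split.
  rewrite (iprodE (iprodM (omegaq_cvg hr Sx Sy) (omegaq_cvg hs Sx Sy))).
  by rewrite !mehler_omegaq// invfM; ring.
rewrite /fCN -(mehler_omegaq hr Sx Sy) -(mehler_omegaq hs Sy Sx) (mehlerC _ sigma).
by ring.
Qed.

End Density.

Theorem theorem1 (R : realType) (q rho12 rho13 rho23 : R)
    (hq : -1 < q < 1) (h12 : -1 < rho12 < 1) (h13 : -1 < rho13 < 1)
    (h23 : -1 < rho23 < 1) :
  let r := rho12 * rho13 * rho23 in
  C3D q rho12 rho13 rho23 = 1 - r /\
  (forall rho12' rho13' : R, -1 < rho12' < 1 -> -1 < rho13' < 1 ->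
     rho12' * rho13' = rho12 * rho13 ->
     forall y z : R, Sq q y -> Sq q z ->
       fYZ q rho12' rho13' rho23 y z = fYZ q rho12 rho13 rho23 y z) /\
  (forall y z : R, Sq q y -> Sq q z ->
     fYZ q rho12 rho13 rho23 y z =
       (1 - r) * fN q y * fN q z
       * ((qpoch q (rho23 ^+ 2) * qpoch q (rho12 ^+ 2 * rho13 ^+ 2))
          / iprod (fun i => omegaq q y z (rho23 * q ^+ i)
                            * omegaq q y z (rho12 * rho13 * q ^+ i))) /\
     fYZ q rho12 rho13 rho23 y z =
       (1 - r) * fCN q y z rho23 * fCN q z y (rho12 * rho13)) /\
  (forall rho12' rho23' : R, -1 < rho12' < 1 -> -1 < rho23' < 1 ->
     rho12' * rho23' = rho12 * rho23 ->
     forall x z : R, Sq q x -> Sq q z ->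
       fXZ q rho12' rho13 rho23' x z = fXZ q rho12 rho13 rho23 x z) /\
  (forall x z : R, Sq q x -> Sq q z ->
     fXZ q rho12 rho13 rho23 x z =
       (1 - r) * fN q x * fN q z
       * ((qpoch q (rho13 ^+ 2) * qpoch q (rho12 ^+ 2 * rho23 ^+ 2))
          / iprod (fun i => omegaq q x z (rho13 * q ^+ i)
                            * omegaq q x z (rho12 * rho23 * q ^+ i))) /\
     fXZ q rho12 rho13 rho23 x z =
       (1 - r) * fCN q x z rho13 * fCN q z x (rho12 * rho23)) /\
  (forall rho13' rho23' : R, -1 < rho13' < 1 -> -1 < rho23' < 1 ->
     rho13' * rho23' = rho13 * rho23 ->
     forall x y : R, Sq q x -> Sq q y ->
       fXY q rho12 rho13' rho23' x y = fXY q rho12 rho13 rho23 x y) /\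
  (forall x y : R, Sq q x -> Sq q y ->
     fXY q rho12 rho13 rho23 x y =
       (1 - r) * fN q x * fN q y
       * ((qpoch q (rho12 ^+ 2) * qpoch q (rho13 ^+ 2 * rho23 ^+ 2))
          / iprod (fun i => omegaq q x y (rho12 * q ^+ i)
                            * omegaq q x y (rho13 * rho23 * q ^+ i))) /\
     fXY q rho12 rho13 rho23 x y =
       (1 - r) * fCN q x y rho12 * fCN q y x (rho13 * rho23)) /\
  (forall rho12' rho13' rho23' : R,
     -1 < rho12' < 1 -> -1 < rho13' < 1 -> -1 < rho23' < 1 ->
     rho12' * rho13' * rho23' = r ->
     forall x : R, Sq q x ->
       fX q rho12' rho13' rho23' x = fX q rho12 rho13 rho23 x) /\
  (forall x : R, Sq q x -> fX q rho12 rho13 rho23 x = fR q x r) /\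
  (forall rho12' rho13' rho23' : R,
     -1 < rho12' < 1 -> -1 < rho13' < 1 -> -1 < rho23' < 1 ->
     rho12' * rho13' * rho23' = r ->
     forall y : R, Sq q y ->
       fY q rho12' rho13' rho23' y = fY q rho12 rho13 rho23 y) /\
  (forall y : R, Sq q y -> fY q rho12 rho13 rho23 y = fR q y r) /\
  (forall rho12' rho13' rho23' : R,
     -1 < rho12' < 1 -> -1 < rho13' < 1 -> -1 < rho23' < 1 ->
     rho12' * rho13' * rho23' = r ->
     forall z : R, Sq q z ->
       fZ q rho12' rho13' rho23' z = fZ q rho12 rho13 rho23 z) /\
  (forall z : R, Sq q z -> fZ q rho12 rho13 rho23 z = fR q z r).
Proof.
have n1 x : -1 < x < 1 -> `|x : R| < 1 by rewrite ltr_norml.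
move: h12 h13 h23 => /n1 {}h12 /n1 {}h13 /n1 {}h23 r.
split; first exact: C3D_value.
split.
  move=> a b /n1 ha /n1 hb ab y z Sy Sz.
  by rewrite !fYZ_mehler// ab.
split.
  move=> y z Sy Sz; rewrite fYZ_mehler//.
  by apply: mehler_pair_closed_form => //; [exact: norm_mul_lt1|rewrite exprMn].
split.
  move=> a b /n1 ha /n1 hb ab x z Sx Sz.
  have E : a * rho13 * b = r by rewrite mulrAC ab mulrAC.
  by rewrite !fXZ_mehler// E ab.
split.
  move=> x z Sx Sz; rewrite fXZ_mehler//.
  by apply: mehler_pair_closed_form => //; [exact: norm_mul_lt1|rewrite exprMn].
split.
  move=> a b /n1 ha /n1 hb ab x y Sx Sy.
  have E : rho12 * a * b = r by rewrite -mulrA ab mulrA.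
  by rewrite !fXY_mehler// E ab.
split.
  move=> x y Sx Sy; rewrite fXY_mehler//.
  by apply: mehler_pair_closed_form => //; [exact: norm_mul_lt1|rewrite exprMn].
split; first by move=> a b c /n1 ha /n1 hb /n1 hc abc x Sx; rewrite !fX_fR// abc.
split; first by move=> x Sx; rewrite fX_fR.
split; first by move=> a b c /n1 ha /n1 hb /n1 hc abc y Sy; rewrite !fY_fR// abc.
split; first by move=> y Sy; rewrite fY_fR.
split; first by move=> a b c /n1 ha /n1 hb /n1 hc abc z Sz; rewrite !fZ_fR// abc.
by move=> z Sz; rewrite fZ_fR.
Qed.
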